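(* Let $G=(V,E)$ be a directed graph (with a self-loop at each vertex) and let $\pi:V\to\mathbb{R}_{\ge 0}$ be a vertex weight function. Then \[ \vec{\lambda}_2^{v*}(G) \lesssim \vec{\psi}(G) \lesssim \sqrt{\vec{\lambda}_2^{v*}(G)\cdot \log\frac{\Delta}{\vec{\psi}(G)}} \lesssim \sqrt{\vec{\lambda}_2^{v*}(G)\cdot \log\frac{\Delta}{\vec{\lambda}_2^{v*}(G)}}, \] where $\Delta$ is the maximum unweighted total degree (indegree plus outdegree) of a vertex of $G$.
   Context: Notation: $f\lesssim g$ means $f\le c\,g$ for some absolute constant $c>0$. For $S\subseteq V$, $\overline S=V\setminus S$, $\pi(S)=\sum_{v\in S}\pi(v)$, and $\partial^+(S)=\{v\notin S:\exists u\in S \text{ with } uv\in E\}$ is the set of out-neighbours of $S$. The directed vertex expansion is $\vec\psi(S)=\frac{\min\{\pi(\partial^+(S)),\pi(\partial^+(\overline S))\}}{\min\{\pi(S),\pi(\overline S)\}}$ and $\vec\psi(G)=\min_{\emptyset\ne S\subsetneq V}\vec\psi(S)$. Let $\Pi=\mathrm{diag}(\pi)$. The maximum reweighted spectral gap with vertex capacity constraints is $\vec{\lambda}_2^{v*}(G)=\max\ \lambda_2\big(I-\Pi^{-1/2}\tfrac{A+A^T}{2}\Pi^{-1/2}\big)$ over nonnegative matrices $A\in\mathbb{R}^{V\times V}$ with $A(u,v)=0$ for all $uv\notin E$, $\sum_v A(u,v)=\sum_v A(v,u)$ for all $u$ (Eulerian), and $\sum_v A(u,v)=\pi(u)$ for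 all $u$; here $\lambda_2(\cdot)$ is the second smallest eigenvalue. Standing assumption: $G$ has a self-loop at each vertex (so the program is feasible). *)

(* Defs.v *)
From HB Require Import structures.
From mathcomp Require Import all_boot all_order all_algebra.
From mathcomp Require Import polyrcf.
From mathcomp Require Import classical_sets reals exp.

Set Implicit Arguments.
Unset Strict Implicit.
Unset Printing Implicit Defensive.

Import Order.TTheory GRing.Theory Num.Theory.

Local Open Scope ring_scope.

(* A directed graph on V is its edge relation: E u v means uv \in E.          *)

Definition out_neighbours (V : finType) (E : rel V) (S : {set V}) : {set V} :=
  [set v | (v \notin S) && [exists u in S, E u v]]%SET.

Definition max_total_degree (V : finType) (E : rel V) : nat :=
  (\max_(v : V) (#|[pred u | E v u]| + #|[pred u | E u v]|))%N.

Section Expansion.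
Variables (R : realType) (V : finType) (E : rel V) (w : V -> R).

Definition weight (S : {set V}) : R := \sum_(v in S) w v.

Definition dvexp_set (S : {set V}) : R :=
  Num.min (weight (out_neighbours E S)) (weight (out_neighbours E (~: S)%SET))
  / Num.min (weight S) (weight (~: S)%SET).

(* The last condition says that the denominator of dvexp_set S is nonzero.
   It is implied by the first two when w is positive; when w has zeros, it
   discards the cuts whose expansion is the undefined quotient 0 / 0, which
   would otherwise evaluate to 0. *)
Definition dvexp_cut (S : {set V}) : bool :=
  [&& S != finset.set0, S != finset.setT
    & 0 < Num.min (weight S) (weight (~: S)%SET)].

(* The infimum of a finite set of values, hence their minimum. *)
Definition dvexp : R :=
  inf [set r : R | exists2 S : {set V}, dvexp_cut S & r = dvexp_set S]%classic.

End Expansion.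

Section Spectrum.
Variables (R : realType) (n : nat).

(* The real roots of the characteristic polynomial in nondecreasing order,
   each repeated according to its multiplicity. *)
Definition eigenvalues (M : 'M[R]_n) : seq R :=
  flatten [seq nseq (mup x (char_poly M)) x | x <- rootsR (char_poly M)].

Definition lambda2 (M : 'M[R]_n) : R := nth 0 (eigenvalues M) 1.

End Spectrum.

Section ReweightedEigenvalue.
Variables (R : realType) (V : finType) (E : rel V) (w : V -> R).

Definition feasible (A : V -> V -> R) : Prop :=
  [/\ forall u v, 0 <= A u v,
      forall u v, ~~ E u v -> A u v = 0,
      forall u, \sum_v A u v = \sum_v A v u
    & forall u, \sum_v A u v = w u].

Definition adjacency (A : V -> V -> R) : 'M[R]_#|V| :=
  \matrix_(i, j) A (enum_val i) (enum_val j).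

(* Since 0^-1 = 0, this is the pseudo-inverse square root of diag(w) when w
   has zeros; the rows and columns of a feasible A vanish there. *)
Definition inv_sqrt_weight : 'M[R]_#|V| :=
  diag_mx (\row_i (Num.sqrt (w (enum_val i)))^-1).

Definition normalized_laplacian (A : V -> V -> R) : 'M[R]_#|V| :=
  1%:M - inv_sqrt_weight
         *m (2^-1 *: (adjacency A + (adjacency A)^T))
         *m inv_sqrt_weight.

(* The supremum is attained: the feasible A form a compact set, nonempty when
   E is reflexive and w nonnegative, on which lambda2 is continuous. *)
Definition max_reweighted_gap : R :=
  sup [set r : R | exists2 A : V -> V -> R,
         feasible A & r = lambda2 (normalized_laplacian A)]%classic.

End ReweightedEigenvalue.

(* Main.v *)
Require Import Defs.
From HB Require Import structures.
From mathcomp Require Import all_boot all_order all_algebra.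
From mathcomp Require Import polyrcf complex.
From mathcomp Require Import boolp classical_sets reals.
From mathcomp Require Import topology normedtype derive sequences exp.
From mathcomp Require Import sesquilinear spectral.
From mathcomp Require Import ring lra.

(* For a cut S and a feasible A, the quadratic form of the normalized Laplacian
   on the plane spanned by sqrt w on S and sqrt w on its complement is at most
   2 * dvexp_set S times the squared norm; this gives lam <= 2 psi.

   For the converse, normalize w to total mass 1. By conic duality, if no
   feasible A has spectral gap lam, there are vectors f(v), with squared norms
   of w-mean 1 and f of w-mean 0, and functions a and q >= 0 such that
     |f u - f v|^2 / 2 <= q v + a u - a v  on every edge uv,  sum w q <= lam.
   If H u - H v <= p v on every edge, the coarea formula bounds psi times the
   mean oscillation sum_(u, v) w u w v |H u - H v| by 2 * sum w p. Apply it to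
     - a, which shows that a oscillates by at most 2 lam / psi;
     |f|^2 - c a with c = 2 / sqrt lam: the quadratic gain of a along an edge
       absorbs the cross term in |f u|^2 - |f v|^2, so |f|^2 is within
       O(sqrt lam / psi) of 1 in mean;
     x - c a with x a random +-1 combination of the coordinates of f: now a
       absorbs the fluctuation of x, the excess over the at most Delta
       in-neighbours of a vertex being O(ln Delta / c) on average.
   By Khintchine's inequality x has mean oscillation bounded below, and the
   choice c ~ sqrt (ln Delta / lam) yields psi^2 = O(lam ln Delta). As psi <= 1,
   this is stronger than the bound with ln (Delta / psi). *)

Set Implicit Arguments.
Unset Strict Implicit.
Unset Printing Implicit Defensive.

Import Order.TTheory GRing.Theory Num.Theory numFieldNormedType.Exports.
Local Open Scope ring_scope.

(** * Isoperimetry and Lipschitz functions *)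

Section Coarea.
Variables (R : realType) (V : finType) (E : rel V) (w : V -> R) (psi : R).
Hypothesis w_ge0 : forall v, 0 <= w v.
Hypothesis w_sum1 : \sum_v w v = 1.
Hypothesis psi_ge0 : 0 <= psi.
Hypothesis iso : forall S : {set V},
  psi * Num.min (weight w S) (weight w (~: S)) <= weight w (out_neighbours E S).

Lemma weight_ge0 (S : {set V}) : 0 <= weight w S.
Proof. by apply: sumr_ge0. Qed.

Lemma sum_indicator (S : {set V}) : \sum_v w v * (v \in S)%:R = weight w S.
Proof.
rewrite /weight [RHS]big_mkcond; apply: eq_bigr => v _.
by case: (v \in S); rewrite ?mulr1 ?mulr0.
Qed.

(* Induction on the number of strict inequalities, closing the gap [g] between
   the largest value of [H], attained on [S], and the next one. *)
Lemma coarea_median (H p : V -> R) :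
  (forall v, 0 <= p v) -> (forall u v, E u v -> H u - H v <= p v) ->
  exists m, psi * (\sum_v w v * `|H v - m|) <= \sum_v w v * p v.
Proof.
have [n] := ubnP #|[set uv : V * V | H uv.1 < H uv.2]|.
elim: n H p => // n IHn H p; rewrite ltnS => Hn p_ge0 Hp.
have [/existsP[x0 /existsP[y0 xy0]] | /existsPn Hc] :=
  boolP [exists x, exists y, H x < H y]; last first.
  have [v0 _ | V0] := pickP (fun _ : V => true); last first.
    by exists 0; rewrite !big_pred0 ?mulr0.
  exists (H v0); rewrite big1 ?mulr0; first by apply: sumr_ge0 => v _; rewrite mulr_ge0.
  move=> v _; have /existsPn/(_ v0) := Hc v; have /existsPn/(_ v) := Hc v0.
  by rewrite -!leNgt => h1 h2; rewrite (le_anti (introT andP (conj h1 h2))) subrr normr0 mulr0.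
pose M := H [arg max_(v > x0) H v]%O.
have HM v : H v <= M by rewrite /M; case: arg_maxP => // i _; apply.
have [t HtM] : exists t, H t = M by exists [arg max_(v > x0) H v]%O.
have x0M : H x0 < M by apply: lt_le_trans xy0 _.
pose z := [arg max_(v > x0 | H v < M) H v]%O.
have [zM HzM] : H z < M /\ forall v, H v < M -> H v <= H z.
  by rewrite /z; case: arg_maxP.
pose M' := H z; pose S := [set v | H v == M].
have HS v : v \notin S -> H v <= M'.
  by rewrite inE => Hv; apply: HzM; rewrite lt_neqAle Hv HM.
pose g := M - M'; have g_gt0 : 0 < g by rewrite subr_gt0.
(* [H1] merges the top level set [S] with the level [M'] below it. The pair [(z, t)] stops being a
   strict inequality and no new one appears. *)
pose H1 v := H v - g * (v \in S)%:R.
have H1S v : v \in S -> H1 v = M'.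
  by move=> Sv; rewrite /H1 Sv; move: Sv; rewrite inE => /eqP ->; rewrite mulr1 subKr.
have H1N v : v \notin S -> H1 v = H v.
  by rewrite /H1 => /negbTE ->; rewrite mulr0 subr0.
have H1M v : H1 v <= M'.
  by have [/H1S -> | Sv] := boolP (v \in S); rewrite // H1N ?HS.
pose bd := out_neighbours E S.
(* Outside [S], only vertices of [bd] have an edge from [S]. There [p v >= M - H v >= g], so [p1]
   stays nonnegative and still bounds the increments of [H1]. *)
pose p1 v := p v - g * (v \in bd)%:R.
have bdP v : v \in bd -> v \notin S /\ M - H v <= p v.
  rewrite inE => /andP[Sv /exists_inP[u Su Euv]]; split => //.
  by move: Su; rewrite inE => /eqP <-; apply: Hp.
have [|||m Hm] := IHn H1 p1.
- apply: leq_trans Hn; apply: proper_card; apply/properP; split.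
    apply/fintype.subsetP=> -[u v]; rewrite !inE /= => uv.
    have [Su|Su] := boolP (u \in S); first by move: uv; rewrite (H1S u) // ltNge H1M.
    have [Sv|Sv] := boolP (v \in S); last by move: uv; rewrite !H1N.
    move: uv; rewrite (H1N u) // (H1S v) // => /lt_trans; apply.
    by move: Sv; rewrite inE => /eqP ->.
  exists (z, t); rewrite !inE /= ?HtM // (H1S t) ?inE ?HtM //.
  by rewrite H1N ?ltxx // inE lt_eqF.
- move=> v; rewrite /p1; have [/bdP[Sv] | _] := boolP (v \in bd); last by rewrite mulr0 subr0.
  by rewrite mulr1 subr_ge0; apply: le_trans; rewrite /g lerB // HS.
- move=> u v Euv; rewrite /p1; have [/bdP[Sv] | bv] := boolP (v \in bd).
    rewrite mulr1 (H1N v) // /g => h; have := H1M u; lra.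
  rewrite mulr0 subr0; have [Sv|Sv] := boolP (v \in S).
    by rewrite (H1S v) //; apply: le_trans (p_ge0 v); rewrite subr_le0.
  have [Su|Su] := boolP (u \in S).
    by case/negP: bv; rewrite inE Sv; apply/exists_inP; exists u.
  by rewrite !H1N // Hp.
have Ep : \sum_v w v * p v = \sum_v w v * p1 v + g * weight w bd.
  rewrite -sum_indicator mulr_sumr -big_split /=; apply: eq_bigr => v _.
  by rewrite /p1; ring.
(* Restoring [g] on [S] moves only the lighter side away from the centre: [m] is kept if [S] is
   lighter, and becomes [m + g] if the complement is. *)
have := iso S; rewrite -/bd minElt; case: ifP => _ Hiso.
- exists m; rewrite Ep.
  apply: (@le_trans _ _ (psi * (\sum_v w v * `|H1 v - m| + g * weight w S))).
    apply: ler_wpM2l => //; rewrite -sum_indicator mulr_sumr -big_split /=.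
    apply: ler_sum => v _; rewrite mulrCA -mulrDr ler_wpM2l // /H1.
    have e : H v - m = (H v - g * (v \in S)%:R - m) + g * (v \in S)%:R by ring.
    rewrite [X in `|X| <= _]e; apply: le_trans (ler_normD _ _) _; rewrite lerD2l ger0_norm //.
    by rewrite mulr_ge0 // ltW.
  by rewrite mulrDr lerD // mulrCA ler_wpM2l // ltW.
- exists (m + g); rewrite Ep.
  apply: (@le_trans _ _ (psi * (\sum_v w v * `|H1 v - m| + g * weight w (~: S)))).
    apply: ler_wpM2l => //; rewrite -sum_indicator mulr_sumr -big_split /=.
    apply: ler_sum => v _; rewrite mulrCA -mulrDr ler_wpM2l // /H1 finset.in_setC.
    have e : H v - (m + g) = (H v - g * (v \in S)%:R - m) - g * (v \notin S)%:R.
      by case: (v \in S) => /=; ring.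
    rewrite e; apply: le_trans (ler_normB _ _) _; rewrite lerD2l ger0_norm //.
    by rewrite mulr_ge0 // ltW.
  by rewrite mulrDr lerD // mulrCA ler_wpM2l // ltW.
Qed.

(** By the triangle inequality through the centre [m] of [coarea_median], the mean oscillation is at
    most twice the mean deviation from [m]. *)
Lemma coarea (H p : V -> R) :
  (forall v, 0 <= p v) -> (forall u v, E u v -> H u - H v <= p v) ->
  psi * (\sum_u \sum_v w u * w v * `|H u - H v|) <= 2 * \sum_v w v * p v.
Proof.
move=> p_ge0 Hp; have [m Hm] := coarea_median p_ge0 Hp.
apply: le_trans (_ : psi * (2 * \sum_v w v * `|H v - m|) <= _); last first.
  by rewrite mulrCA ler_wpM2l.
apply: ler_wpM2l => //.
apply: (@le_trans _ _ (\sum_u \sum_v (w u * `|H u - m| * w v + w u * (w v * `|H v - m|)))).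
  apply: ler_sum => u _; apply: ler_sum => v _.
  rewrite [leRHS](_ : _ = w u * w v * (`|H u - m| + `|H v - m|)); last by ring.
  rewrite ler_wpM2l ?mulr_ge0 //.
  by rewrite (distrC (H v)); exact: ler_distD.
under eq_bigr => u _ do rewrite big_split /= -!mulr_sumr w_sum1 mulr1.
by rewrite big_split /= -mulr_suml w_sum1 mul1r [2 * _]mulr_natl mulr2n.
Qed.

End Coarea.

(** * Random signs *)

Section SignedAverage.
Variables (R : realType) (V : finType).
Implicit Types (ys : seq (V -> R)) (Phi Psi : (V -> R) -> R) (x y : V -> R).

(* The average of [Phi (x + sum_y e_y y)] over independent uniform signs [e_y]. *)
Fixpoint signed_avg ys Phi x : R :=
  if ys is y :: ys' then
    2^-1 * (signed_avg ys' Phi (fun v => x v + y v) +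
            signed_avg ys' Phi (fun v => x v - y v))
  else Phi x.

Lemma ler_signed_avg ys Phi Psi x :
  (forall z, Phi z <= Psi z) -> signed_avg ys Phi x <= signed_avg ys Psi x.
Proof.
by move=> h; elim: ys x => //= y ys IH x; rewrite ler_wpM2l ?invr_ge0 // lerD.
Qed.

Lemma signed_avgD ys Phi Psi x :
  signed_avg ys (fun z => Phi z + Psi z) x = signed_avg ys Phi x + signed_avg ys Psi x.
Proof. by elim: ys x => //= y ys IH x; rewrite !IH; ring. Qed.

Lemma signed_avgZ ys c Phi x :
  signed_avg ys (fun z => c * Phi z) x = c * signed_avg ys Phi x.
Proof. by elim: ys x => //= y ys IH x; rewrite !IH; ring. Qed.

Lemma signed_avg_cst ys c x : signed_avg ys (fun=> c) x = c.
Proof. by elim: ys x => //= y ys IH x; rewrite !IH; field. Qed.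

Lemma signed_avg_sum (I : Type) (r : seq I) (P : pred I) (F : I -> (V -> R) -> R) ys x :
  signed_avg ys (fun z => \sum_(i <- r | P i) F i z) x =
  \sum_(i <- r | P i) signed_avg ys (F i) x.
Proof.
elim: ys x => //= y ys IH x; rewrite !IH.
by rewrite -big_split mulr_sumr.
Qed.

(** A subgaussian bound with a generous constant. For [t >= 1/2] it follows from [t <= 2 * t ^+ 2];
    for smaller [t], from [expR s <= 1 + s + 2 * s ^+ 2], a consequence of
    [(1 - s) * expR s <= 1]. *)
Lemma cosh_le (t : R) : 2^-1 * (expR t + expR (- t)) <= expR (2 * t ^+ 2).
Proof.
wlog t0 : t / 0 <= t.
  move=> h; have [/h //|/ltW t0] := leP 0 t.
  by have := h (- t); rewrite oppr_ge0 sqrrN opprK addrC; apply.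
have [t1|t1] := leP (2^-1) t.
  have h1 : expR (- t) <= expR t by rewrite ler_expR; lra.
  apply: (@le_trans _ _ (expR t)); first by lra.
  rewrite ler_expR; nra.
have e1 (s : R) : - 2^-1 < s < 2^-1 -> expR s <= 1 + s + 2 * s ^+ 2.
  move=> /andP[s1 s2]; have := expR_ge1Dx (- s); rewrite expRN => h.
  have p := expR_gt0 s.
  have : (1 - s) * expR s <= 1.
    by rewrite -ler_pdivlMr // div1r.
  nra.
have h1 := e1 t; have h2 := e1 (- t).
apply: le_trans (expR_ge1Dx _).
have := h1 ltac:(apply/andP; split; lra); have := h2 ltac:(apply/andP; split; lra).
nra.
Qed.

(** Hoeffding's argument: each sign contributes one factor, bounded by [cosh_le] at
    [s * (y u - y v)]. *)
Lemma signed_avg_mgf ys (s : R) u v x :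
  signed_avg ys (fun z => expR (s * (z u - z v))) x <=
  expR (s * (x u - x v) + 2 * s ^+ 2 * \sum_(y <- ys) (y u - y v) ^+ 2).
Proof.
elim: ys x => [|y ys IH] x /=; first by rewrite big_nil mulr0 addr0.
rewrite big_cons; set S := \sum_(_ <- _) _ in IH *.
apply: (@le_trans _ _ (2^-1 * (expR (s * (x u + y u - (x v + y v)) + 2 * s ^+ 2 * S) +
                              expR (s * (x u - y u - (x v - y v)) + 2 * s ^+ 2 * S)))).
  by rewrite ler_wpM2l ?invr_ge0 // lerD // IH.
set t := s * (y u - y v).
rewrite (_ : s * (x u + y u - (x v + y v)) + _ = (s * (x u - x v) + 2 * s ^+ 2 * S) + t);
  last by rewrite /t; ring.
rewrite (_ : s * (x u - y u - (x v - y v)) + _ = (s * (x u - x v) + 2 * s ^+ 2 * S) + - t);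
  last by rewrite /t; ring.
rewrite !(expRD _ t) !(expRD _ (- t)) -mulrDr mulrCA.
rewrite [X in _ <= expR X](_ : _ = (s * (x u - x v) + 2 * s ^+ 2 * S) + 2 * t ^+ 2);
  last by rewrite /t; ring.
by rewrite [leRHS]expRD ler_wpM2l ?expR_ge0 // cosh_le.
Qed.

Lemma signed_avg_sqr ys u x :
  signed_avg ys (fun z => z u ^+ 2) x = x u ^+ 2 + \sum_(y <- ys) y u ^+ 2.
Proof.
elim: ys x => [|y ys IH] x /=; first by rewrite big_nil addr0.
by rewrite !IH big_cons; field.
Qed.

(** Odd powers of [y u] cancel in the average over its sign; each induction step leaves a slack of
    [2 * y u ^+ 4]. *)
Lemma signed_avg_pow4 ys u x : let S := \sum_(y <- ys) y u ^+ 2 in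
  signed_avg ys (fun z => z u ^+ 4) x <= x u ^+ 4 + 6 * x u ^+ 2 * S + 3 * S ^+ 2.
Proof.
elim: ys x => [|y ys IH] x /=.
  by rewrite big_nil mulr0 expr0n /= mulr0 !addr0.
rewrite big_cons; set S := \sum_(_ <- _) _ in IH *.
have h1 := IH (fun v => x v + y v); have h2 := IH (fun v => x v - y v).
rewrite /= in h1 h2; have h3 := sqr_ge0 (y u ^+ 2).
rewrite (_ : x u ^+ 4 + _ + _ =
  2^-1 * (((x u + y u) ^+ 4 + 6 * (x u + y u) ^+ 2 * S + 3 * S ^+ 2) +
   ((x u - y u) ^+ 4 + 6 * (x u - y u) ^+ 2 * S + 3 * S ^+ 2)) + 2 * (y u ^+ 2) ^+ 2).
  lra.
by field.
Qed.

(* Khintchine's inequality, from y >= y^2 - (4/27) y^4 for y >= 0 and the bound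
   E X^4 <= 3 (E X^2)^2. *)
Lemma khintchine ys u :
  2^-1 * Num.sqrt (\sum_(y <- ys) y u ^+ 2) <= signed_avg ys (fun z => `|z u|) (fun=> 0).
Proof.
set S := \sum_(_ <- _) _; set s := Num.sqrt S.
have S0 : 0 <= S by apply: sumr_ge0 => y _; exact: sqr_ge0.
have [/eqP s0|s0] := boolP (s == 0).
  rewrite s0 mulr0; apply: le_trans (_ : signed_avg ys (fun=> 0) (fun=> 0) <= _).
    by rewrite signed_avg_cst.
  exact: ler_signed_avg.
have sp : 0 < s by rewrite lt_neqAle eq_sym s0 sqrtr_ge0.
have sS : s ^+ 2 = S by rewrite sqr_sqrtr.
have key (t : R) : s^-1 * t ^+ 2 + - (4 / 27 * s^-1 ^+ 3) * t ^+ 4 <= `|t|.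
  set r := `|t| / s; have r0 : 0 <= r by rewrite divr_ge0 // ltW.
  have -> : `|t| = s * r by rewrite /r mulrC divfK.
  have -> : s^-1 * t ^+ 2 + - (4 / 27 * s^-1 ^+ 3) * t ^+ 4 = s * (r ^+ 2 - 4 / 27 * r ^+ 4).
    have -> : t ^+ 2 = (s * r) ^+ 2 by rewrite /r [s * _]mulrC divfK // -normrX ger0_norm // sqr_ge0.
    have -> : t ^+ 4 = (s * r) ^+ 4.
      by rewrite /r [s * _]mulrC divfK // -normrX ger0_norm // -[4%N]/(2 * 2)%N exprM sqr_ge0.
    by field.
  apply: ler_wpM2l; first exact: ltW.
  rewrite -subr_ge0.
  (* The constant [4 / 27] is the one that makes [3 / 2] a double root. *)
  rewrite (_ : _ - _ = 4 / 27 * r * ((r - 3 / 2) ^+ 2 * (r + 3))); last by field.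
  apply: mulr_ge0; first by apply: mulr_ge0 => //; lra.
  by apply: mulr_ge0; [exact: sqr_ge0 | lra].
apply: le_trans (ler_signed_avg _ _ (fun z => key (z u))).
rewrite signed_avgD !signed_avgZ signed_avg_sqr.
have h := signed_avg_pow4 ys u (fun=> 0).
rewrite /= -/S !expr0n /= !mulr0 !mul0r !add0r in h *.
apply: (@le_trans _ _ (s^-1 * S + - (4 / 27 * s^-1 ^+ 3) * (3 * S ^+ 2))).
  rewrite -sS (_ : _ + _ = 5 / 9 * s); last by field.
  by rewrite ler_wpM2r // ?ltW //; lra.
rewrite lerD2l !mulNr lerN2; apply: ler_wpM2l => //; apply: mulr_ge0; first by lra.
by rewrite exprn_ge0 // invr_ge0 ltW.
Qed.

End SignedAverage.

(** * Rounding a dual solution *)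

(** Signed sums of functions of [w]-mean 0 again have [w]-mean 0, so [Phi] and [Psi] need comparing
    only there. Quantifying over [nth] says that each member of [ys] is centred. *)
Lemma ler_signed_avg_centered (R : realType) (V : finType) (w : V -> R) ys
    (Phi Psi : (V -> R) -> R) x :
  (forall i, \sum_u w u * nth (fun=> 0) ys i u = 0) -> \sum_u w u * x u = 0 ->
  (forall z, \sum_u w u * z u = 0 -> Phi z <= Psi z) ->
  signed_avg ys Phi x <= signed_avg ys Psi x.
Proof.
move=> + + h; elim: ys x => [|y ys IH] x ys0 x0 /=; first exact: h.
have y0 := ys0 0%N; rewrite /= in y0.
rewrite ler_wpM2l ?invr_ge0 // lerD // IH // => [i|||]; try exact: (ys0 i.+1).
- by under eq_bigr do rewrite mulrDr; rewrite big_split /= x0 y0 addr0.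
- by move=> i; exact: (ys0 i.+1).
- by under eq_bigr do rewrite mulrBr; rewrite sumrB x0 y0 subr0.
Qed.

Lemma ln2_ge (R : realType) : 2^-1 <= ln 2 :> R.
Proof.
have h := expR_ge1Dx (- 2^-1 : R); rewrite expRN in h.
have p := expR_gt0 (2^-1 : R).
have {h} : 2^-1 * expR 2^-1 <= 1 :> R by rewrite -ler_pdivlMr // div1r; lra.
move=> h; rewrite -[leLHS]expRK ler_ln ?posrE //; lra.
Qed.

(** Concavity of [ln] at [y]. Being linear in [x], the bound replaces Jensen's inequality when [ln]
    of a random quantity is averaged over signs. *)
Lemma ln_le_tangent (R : realType) (x y : R) : 0 < x -> 0 < y -> ln x <= ln y + x / y - 1.
Proof.
move=> x0 y0; have xy : 0 < x / y by rewrite divr_gt0.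
have := expR_ge1Dx (ln (x / y)); rewrite lnK ?posrE // ln_div ?posrE //; lra.
Qed.

Section Rounding.
Variables (R : realType) (V : finType) (E : rel V) (w : V -> R) (psi lam D : R).
Hypothesis E_refl : forall v, E v v.
Hypothesis w_ge0 : forall v, 0 <= w v.
Hypothesis w_sum1 : \sum_v w v = 1.
Hypothesis psi_gt0 : 0 < psi.
Hypothesis psi_le1 : psi <= 1.
Hypothesis iso : forall S : {set V},
  psi * Num.min (weight w S) (weight w (~: S)) <= weight w (out_neighbours E S).
Hypothesis D_ge2 : 2 <= D.
Hypothesis indeg_le : forall v, #|[pred u | E u v]|%:R <= D.
Hypothesis lam_gt0 : 0 < lam.
Variables (ys : seq (V -> R)) (a q : V -> R).
Hypothesis ys_centered : forall i, \sum_u w u * nth (fun=> 0) ys i u = 0.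
(** The members of [ys] are the coordinates of an embedding of [V]; [F] is its squared norm and [d]
    its squared distance. *)
Let F u := \sum_(y <- ys) y u ^+ 2.
Let d u v := \sum_(y <- ys) (y u - y v) ^+ 2.
Hypothesis ys_normed : \sum_u w u * F u = 1.
Hypothesis q_ge0 : forall v, 0 <= q v.
Hypothesis dual : forall u v, E u v -> d u v <= 2 * (q v + a u - a v).
Hypothesis value_le : \sum_v w v * q v <= lam.

Let d_ge0 u v : 0 <= d u v.
Proof. by apply: sumr_ge0 => y _; exact: sqr_ge0. Qed.

Let psi_ge0 : 0 <= psi := ltW psi_gt0.
Let D_gt0 : 0 < D := lt_le_trans (ltr0Sn R 1) D_ge2.
Let lnD_ge : 2^-1 <= ln D.
Proof. apply: le_trans (ln2_ge R) _; by rewrite ler_ln ?posrE. Qed.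

Let osc (H : V -> R) : R := \sum_u \sum_v w u * w v * `|H u - H v|.

Let osc_triangle (H G : V -> R) c : 0 <= c ->
  osc H <= osc (fun v => H v - c * G v) + c * osc G.
Proof.
move=> c0; rewrite /osc mulr_sumr -big_split /=; apply: ler_sum => u _.
rewrite mulr_sumr -big_split /=; apply: ler_sum => v _.
rewrite [leRHS](_ : _ =
  w u * w v * (`|H u - c * G u - (H v - c * G v)| + c * `|G u - G v|)); last by ring.
have -> : c * `|G u - G v| = `|c * (G u - G v)| by rewrite normrM ger0_norm.
rewrite ler_wpM2l ?mulr_ge0 //.
apply: le_trans (ler_normD _ _); rewrite le_eqVlt; apply/orP; left; apply/eqP; congr `|_|; ring.
Qed.

(** As [w] has mass 1, [H u - m] is the [w]-average over [v] of [H u - H v]. *)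
Let osc_mean (H : V -> R) m : \sum_u w u * H u = m ->
  \sum_u w u * `|H u - m| <= osc H.
Proof.
move=> Hm; apply: ler_sum => u _.
have -> : H u - m = \sum_v w v * (H u - H v).
  under eq_bigr do rewrite mulrBr.
  by rewrite sumrB -mulr_suml w_sum1 mul1r Hm.
under [leRHS]eq_bigr do rewrite -mulrA.
rewrite -mulr_sumr ler_wpM2l //; apply: le_trans (ler_norm_sum _ _ _) _.
by apply: ler_sum => v _; rewrite normrM ger0_norm.
Qed.

Let osc_potential : psi * osc a <= 2 * lam.
Proof.
apply: le_trans (_ : 2 * \sum_v w v * q v <= _); last by rewrite ler_wpM2l.
have -> : osc a = osc (fun v => - a v).
  by apply: eq_bigr => u _; apply: eq_bigr => v _; rewrite -normrN; congr (_ * `|_|); ring.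
apply: coarea => // u v Euv; have := dual Euv; have := d_ge0 u v; lra.
Qed.

(* For an edge uv the increment of [F - c a] is at most the maximum over t of
   [2 (y v) t - (c/4) t^2], summed over [ys], plus [c (q v)]. *)
Let norm_concentration (s : R) : 0 < s -> s ^+ 2 = lam -> lam <= 4^-1 ->
  psi * \sum_u w u * `|F u - 1| <= 12 * s.
Proof.
move=> s0 sl l4; have s2 : s <= 2^-1 by nra.
(* This choice makes [c * lam] and [4 / c] both equal to [2 * s]; [c >= 4] leaves a nonnegative
   coefficient of [t ^+ 2] below. *)
pose c := 2 / s; have c0 : 0 < c by rewrite divr_gt0.
have c4 : 4 <= c by rewrite ler_pdivlMr //; lra.
apply: le_trans (_ : psi * osc F <= _); first by rewrite ler_wpM2l // osc_mean.
apply: le_trans (_ : psi * (osc (fun v => F v - c * a v) + c * osc a) <= _).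
  by rewrite ler_wpM2l // osc_triangle // ltW.
have h1 : c * (psi * osc a) <= c * (2 * lam) by rewrite ler_wpM2l // ltW.
have h2 : psi * osc (fun v => F v - c * a v) <= 2 * \sum_v w v * (c * q v + 4 / c * F v).
  apply: coarea => // [v|u v Euv].
    rewrite addr_ge0 ?mulr_ge0 ?invr_ge0 //; try exact: ltW.
    by apply: sumr_ge0 => y _; exact: sqr_ge0.
  have e : F u - F v <= c / 2 * d u v + 4 / c * F v.
    rewrite /F /d !mulr_sumr -sumrB -big_split /=; apply: ler_sum => y _.
    set t := y u - y v; have -> : y u = y v + t by rewrite /t; ring.
    rewrite -subr_ge0.
    have -> : c / 2 * t ^+ 2 + 4 / c * y v ^+ 2 - ((y v + t) ^+ 2 - y v ^+ 2)
       = (c / 4 - 1) * t ^+ 2 + (c / 4) * (t - 4 / c * y v) ^+ 2 by field; rewrite gt_eqF.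
    by rewrite addr_ge0 // mulr_ge0 ?sqr_ge0 //; lra.
  have := dual Euv; nra.
have h3 : \sum_v w v * (c * q v + 4 / c * F v) <= c * lam + 4 / c.
  under eq_bigr do rewrite mulrDr (mulrCA (w _) c) (mulrCA (w _) (4 / c)).
  by rewrite big_split /= -!mulr_sumr ys_normed mulr1 lerD2r ler_wpM2l // ltW.
have e1 : c * lam = 2 * s by rewrite -sl /c; field; rewrite gt_eqF.
have e2 : 4 / c = 2 * s by rewrite /c; field; rewrite gt_eqF.
rewrite mulrDr [psi * (c * _)]mulrCA; lra.
Qed.

(* The increment of [x - 4 k a] along an edge uv is at most [4 k q v + ln Z / k],
   while the factor [expR (- 2 k^2 d)] gives every summand a mean of at most 1. *)
Let Z (k : R) v (x : V -> R) : R :=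
  \sum_(u | E u v) expR (k * (x u - x v)) * expR (- (2 * k ^+ 2 * d u v)).

Let Z_ge1 k v x : 1 <= Z k v x.
Proof.
rewrite /Z (bigD1 v) //= subrr mulr0 expR0 mul1r.
have -> : d v v = 0 by rewrite /d big1 // => y _; rewrite subrr expr0n.
rewrite mulr0 oppr0 expR0 lerDl; apply: sumr_ge0 => u _.
by rewrite mulr_ge0 ?expR_ge0.
Qed.

Let Z_avg k v : signed_avg ys (Z k v) (fun=> 0) <= D.
Proof.
apply: le_trans (indeg_le v); rewrite signed_avg_sum -sum1_card natr_sum.
apply: ler_sum => u _.
under [F in signed_avg _ F _]boolp.eq_fun do rewrite mulrC.
rewrite signed_avgZ mulrC.
apply: le_trans
  (_ : expR (k * (0 - 0) + 2 * k ^+ 2 * d u v) * expR (- (2 * k ^+ 2 * d u v)) <= _).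
  by rewrite ler_wpM2r ?expR_ge0 // signed_avg_mgf.
by rewrite -expRD subrr mulr0 add0r subrr expR0.
Qed.

Let signed_bound (k : R) x : 0 < k -> \sum_u w u * x u = 0 ->
  psi * \sum_u w u * `|x u| <=
  16 * k * lam + 2 / k * \sum_v w v * (ln D - 1 + D^-1 * Z k v x).
Proof.
(* For this [c], [dual] gives [2 * k * d u v <= c * (q v + a u - a v)]: the potential pays for the
   variance term. *)
move=> k0 x0; pose c := 4 * k; have c0 : 0 < c by rewrite mulr_gt0.
have lnZ v : 0 <= ln (Z k v x) by rewrite ln_ge0.
apply: le_trans (_ : psi * osc x <= _).
  rewrite ler_wpM2l //; have := osc_mean x0.
  by under eq_bigr do rewrite subr0.
apply: le_trans (_ : psi * (osc (fun v => x v - c * a v) + c * osc a) <= _).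
  by rewrite ler_wpM2l // osc_triangle // ltW.
have h1 : c * (psi * osc a) <= c * (2 * lam) by rewrite ler_wpM2l // ltW.
have h2 : psi * osc (fun v => x v - c * a v) <= 2 * \sum_v w v * (c * q v + k^-1 * ln (Z k v x)).
  apply: coarea => // [v|u v Euv].
    by rewrite addr_ge0 ?mulr_ge0 ?invr_ge0 //; exact: ltW.
  have e : k * (x u - x v) - 2 * k ^+ 2 * d u v <= ln (Z k v x).
    rewrite -[leLHS]expRK ler_ln ?posrE ?expR_gt0 //; last first.
      exact: lt_le_trans (Z_ge1 _ _ _).
    rewrite expRD /Z (bigD1 u) //= lerDl; apply: sumr_ge0 => t _.
    by rewrite mulr_ge0 ?expR_ge0.
  have {e} : x u - x v - 2 * k * d u v <= k^-1 * ln (Z k v x).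
    by rewrite ler_pdivlMl //; apply: le_trans e; lra.
  have := dual Euv; rewrite /c; nra.
have h3 : \sum_v w v * (c * q v + k^-1 * ln (Z k v x)) <=
    c * lam + k^-1 * \sum_v w v * (ln D - 1 + D^-1 * Z k v x).
  under eq_bigr do rewrite mulrDr (mulrCA (w _) c) (mulrCA (w _) k^-1).
  rewrite big_split /= -!mulr_sumr lerD ?ler_wpM2l ?invr_ge0 //; try exact: ltW.
  apply: ler_sum => v _; rewrite ler_wpM2l //.
  have := ln_le_tangent (lt_le_trans ltr01 (Z_ge1 k v x)) D_gt0; lra.
rewrite mulrDr [psi * (c * _)]mulrCA; rewrite /c in h1 h2 h3 *; lra.
Qed.

(** Average [signed_bound] over the signs: Khintchine bounds the left side from below, and since [Z]
    has mean at most [D], the term [D^-1 * Z] is absorbed by the [- 1]. *)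
Let avg_bound (k : R) : 0 < k ->
  psi * (2^-1 * \sum_u w u * Num.sqrt (F u)) <= 16 * k * lam + 2 / k * ln D.
Proof.
move=> k0; apply: le_trans
  (_ : signed_avg ys (fun x => psi * \sum_u w u * `|x u|) (fun=> 0) <= _).
  rewrite signed_avgZ signed_avg_sum mulr_sumr ler_wpM2l //.
  by apply: ler_sum => u _; rewrite signed_avgZ mulrCA ler_wpM2l // khintchine.
apply: le_trans (ler_signed_avg_centered ys_centered _ (fun x => @signed_bound k x k0)) _.
  by rewrite big1 // => u _; rewrite mulr0.
rewrite signed_avgD signed_avg_cst signed_avgZ signed_avg_sum lerD2l.
rewrite ler_wpM2l ?divr_ge0 //; first exact: ltW.
rewrite -[leRHS]mul1r -[in leRHS]w_sum1 mulr_suml; apply: ler_sum => v _.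
rewrite signed_avgZ ler_wpM2l // signed_avgD signed_avg_cst.
rewrite (signed_avgZ _ D^-1 (Z k v)) -addrA gerDl addrC subr_le0.
by rewrite ler_pdivrMl // mulr1.
Qed.

Lemma expansion_le_dual_value : psi ^+ 2 <= 5000 * lam * ln D.
Proof.
have lD := lnD_ge; have l0 := lam_gt0; have p1 := psi_le1; have p0 := psi_gt0.
pose s := Num.sqrt lam; pose L := Num.sqrt (ln D).
have s0 : 0 < s by rewrite sqrtr_gt0.
have L0 : 0 < L by rewrite sqrtr_gt0; lra.
have sl : s ^+ 2 = lam by rewrite sqr_sqrtr // ltW.
have Ll : L ^+ 2 = ln D by rewrite sqr_sqrtr //; lra.
have [l4|l4] := leP lam 4^-1; last by nra.
have h := norm_concentration s0 sl l4.
(* If [psi <= 48 * s], then [psi ^+ 2 <= 2304 * lam], which suffices as [ln D >= 1/2]. Otherwise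
   [norm_concentration] puts [F] within [1/4] of 1 in mean. *)
have [p48|p48] := leP psi (48 * s); first by nra.
have F_ge0 u : 0 <= F u by apply: sumr_ge0 => y _; exact: sqr_ge0.
have hF : \sum_u w u * `|F u - 1| <= 4^-1.
  rewrite -(ler_pM2l psi_gt0); lra.
have hS : 3 / 4 <= \sum_u w u * Num.sqrt (F u).
  apply: le_trans (_ : \sum_u w u * (1 - `|F u - 1|) <= _).
    by under eq_bigr do rewrite mulrBr mulr1; rewrite sumrB w_sum1; lra.
  apply: ler_sum => u _; rewrite ler_wpM2l //.
  have := sqr_sqrtr (F_ge0 u); have := sqrtr_ge0 (F u); set t := Num.sqrt _ => t0 <-.
  have := ler_norm (t ^+ 2 - 1); have := ler_norm (- (t ^+ 2 - 1)); rewrite normrN; nra.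
(* At this [k] the two terms of [avg_bound] are [8 * (L * s)] and [4 * (L * s)], while its left side
   is at least [3 / 8 * psi]. *)
have k0 : 0 < L / (2 * s) by rewrite divr_gt0 // mulr_gt0.
have := avg_bound k0; rewrite -sl -Ll.
have -> : 16 * (L / (2 * s)) * s ^+ 2 + 2 / (L / (2 * s)) * L ^+ 2 = 12 * (L * s).
  by field; rewrite !gt_eqF.
move=> hb; have p32 : psi <= 32 * (L * s) by nra.
have : psi ^+ 2 <= (32 * (L * s)) ^+ 2 by rewrite ler_pXn2r // nnegrE // ?mulr_ge0 // ltW.
rewrite !exprMn; have : 0 <= L ^+ 2 * s ^+ 2 by rewrite mulr_ge0 ?sqr_ge0.
lra.
Qed.

End Rounding.

(** * Duality for the reweighting program *)

(** The first-order condition at a minimum along a segment. If [p < 0], the step [- p / t] is at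
    most 1 because [t > - p], and makes the quadratic negative because [2 * t > s]. *)
Lemma ge0_of_quadratic (R : realFieldType) (p s : R) : 0 <= s ->
  (forall e, 0 < e -> e <= 1 -> 0 <= 2 * e * p + e ^+ 2 * s) -> 0 <= p.
Proof.
move=> s0 h; rewrite leNgt; apply/negP => p0.
pose t := - p + s + 1; have t0 : 0 < t by rewrite /t; lra.
have := h (- p / t); rewrite divr_gt0 ?oppr_gt0 // ler_pdivrMr // mul1r.
move=> /(_ isT)/(_ ltac:(rewrite /t; lra)).
have -> : 2 * (- p / t) * p + (- p / t) ^+ 2 * s = (p / t) ^+ 2 * (s - 2 * t).
  by field; rewrite gt_eqF.
have : 0 < (p / t) ^+ 2.
  by rewrite exprn_even_gt0 //= mulf_neq0 ?invr_neq0 // ?(lt_eqF p0) // (gt_eqF t0).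
rewrite /t; nra.
Qed.

Section Continuity.
Local Open Scope classical_set_scope.
Local Open Scope ring_scope.
Variables (R : realType) (X : topologicalType).

Lemma continuous_sum (I : finType) (F : I -> X -> R) :
  (forall i, continuous (F i)) -> continuous (fun x => \sum_i F i x).
Proof. by move=> h; apply: continuous_big => //; exact: add_continuous. Qed.

Lemma continuous_mulr (f : X -> R) c : continuous f -> continuous (fun x => f x * c).
Proof. by move=> h x; apply: cvgM; [exact: h | exact: cvg_cst]. Qed.

Lemma continuous_sub (f g : X -> R) :
  continuous f -> continuous g -> continuous (fun x => f x - g x).
Proof. by move=> hf hg x; apply: cvgB; [exact: hf | exact: hg]. Qed.

Lemma continuous_sum_sqr (J : finType) (T : X -> J -> R) (b : J -> R) :
  (forall j, continuous (fun x => T x j)) ->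
  continuous (fun x => \sum_j (T x j - b j) ^+ 2).
Proof.
move=> Tcont; apply: continuous_sum => j x.
have h : (T z j - b j) @[z --> x] --> T x j - b j.
  by apply: cvgB; [exact: Tcont | exact: cvg_cst].
rewrite /continuous_at expr2; under eq_cvg do rewrite expr2.
exact: cvgM.
Qed.

Lemma closed_ge0 (f : X -> R) : continuous f -> closed [set x | 0 <= f x].
Proof.
move=> h; apply: (@preimage_closed X R f [set t | 0 <= t]); last exact: closed_ge.
by move=> x _; exact: h.
Qed.

Lemma closed_eq0 (f : X -> R) : continuous f -> closed [set x | f x = 0].
Proof.
move=> h; apply: (@preimage_closed X R f [set t | t = 0]); last exact: closed_eq.
by move=> x _; exact: h.
Qed.

End Continuity.

(** * Separation of a point from the linear image of a closed cone *)

Section ConeAlternative.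
Local Open Scope classical_set_scope.
Local Open Scope ring_scope.
Variables (R : realType) (I J : finType).
Let X := prod_topology (fun _ : I => R : topologicalType).

(* Coercivity of [T] on [K] provides a point of [T K] nearest to [b]; the
   residual [y] at that point is the separating functional. *)
Lemma cone_alternative (K : set X) (T : X -> J -> R) (b : J -> R) (B : R) :
  closed K -> K (fun=> 0) ->
  (forall x k c, 0 <= c -> K x -> K k -> K (fun i => x i + c * k i)) ->
  (forall x c, 0 <= c -> K x -> K (fun i => c * x i)) ->
  (forall x k c j, T (fun i => x i + c * k i) j = T x j + c * T k j) ->
  (forall j, continuous (fun x : X => T x j)) ->
  0 <= B -> (forall x i, K x -> `|x i| <= B * \sum_j `|T x j|) ->
  (exists2 x, K x & forall j, T x j = b j) \/
  (exists2 y, forall k, K k -> 0 <= \sum_j y j * T k j & \sum_j y j * b j < 0).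
Proof.
move=> clK K0 KD KZ Tlin Tcont B0 coer.
pose Phi (x : X) := \sum_j (T x j - b j) ^+ 2.
(* Only points with [Phi x <= C] compete for the minimum. Their residuals have squares at most [C],
   hence size at most [1 + C], and coercivity confines their coordinates to [[- r, r]]. *)
pose C := Phi (fun=> 0); pose r := B * \sum_j (`|b j| + 1 + C).
have C0 : 0 <= C by apply: sumr_ge0 => j _; exact: sqr_ge0.
have bdd x i : K x -> Phi x <= C -> `|x i| <= r.
  move=> Kx Px; apply: le_trans (coer x i Kx) _; rewrite ler_wpM2l //.
  apply: ler_sum => j _.
  have h : (T x j - b j) ^+ 2 <= C.
    apply: le_trans Px; rewrite /Phi (bigD1 j) //= lerDl.
    by apply: sumr_ge0 => l _; exact: sqr_ge0.
  have -> : T x j = b j + (T x j - b j) by ring.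
  apply: le_trans (ler_normD _ _) _; rewrite -addrA lerD2l.
  set t := T x j - b j in h *; have := real_normK (num_real t); have := normr_ge0 t; nra.
pose box := [set x : X | forall i, x i \in `[- r, r]].
have cbox : compact box.
  have := @tychonoff I (fun=> R) (fun=> [set` `[- r, r]]) (fun=> @segment_compact R (- r) r).
  by [].
have cA : compact (box `&` K) by exact: compact_closedI.
have r0 : 0 <= r by rewrite mulr_ge0 // sumr_ge0 // => j _; rewrite !addr_ge0.
have in_box x : (forall i, `|x i| <= r) -> box x.
  by move=> h i; rewrite in_itv /= -ler_norml.
have cPhi : continuous Phi.
  exact: continuous_sum_sqr.
have [x0 x0A x0min] : exists2 c, c \in box `&` K & forall t, t \in box `&` K -> Phi c <= Phi t.
  apply: compact_EVT_min => //.
    by exists (fun=> 0); split => //; apply: in_box => i; rewrite normr0.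
  exact: continuous_subspaceT.
have [_ Kx0] := set_mem x0A.
have {x0min} x0min x : K x -> Phi x0 <= Phi x.
  move=> Kx; have x0C : Phi x0 <= C.
    apply: x0min; apply/mem_set; split => //.
    by apply: in_box => i; rewrite normr0.
  have [xC|/ltW xC] := leP (Phi x) C; last exact: le_trans xC.
  by apply: x0min; apply/mem_set; split => //; apply: in_box => i; apply: bdd.
pose y j := T x0 j - b j.
have Phi_at x k c : T x =1 (fun j => T x0 j + c * T k j) ->
    Phi x = Phi x0 + (2 * c * (\sum_j y j * T k j) + c ^+ 2 * \sum_j T k j ^+ 2).
  move=> h; rewrite /Phi !mulr_sumr -!big_split; apply: eq_bigr => j _ /=.
  by rewrite h /y; ring.
have sq_ge0 k : 0 <= \sum_j T k j ^+ 2 by apply: sumr_ge0 => j _; exact: sqr_ge0.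
have [/eqP P0|P0] := boolP (Phi x0 == 0).
  left; exists x0 => // j; apply/eqP; rewrite -subr_eq0 -sqrf_eq0.
  have := P0; rewrite /Phi => /eqP; rewrite psumr_eq0 => [/allP/(_ j)|l _]; last exact: sqr_ge0.
  by rewrite mem_index_enum => /(_ isT) /implyP; apply.
right; exists y => [k Kk|].
  apply: (@ge0_of_quadratic _ _ _ (sq_ge0 k)) => e e0 _.
  have Kx : K (fun i => x0 i + e * k i) by apply: KD => //; exact: ltW.
  have Px := Phi_at _ k e (fun j => Tlin x0 k e j).
  by have := x0min _ Kx; rewrite Px lerDl.
(* Optimality against shrinking [x0] towards the apex. As [y] is the residual, the pairing of [y]
   with [b] is its pairing with [T x0] minus [Phi x0]. *)
have yx0 : 0 <= - \sum_j y j * T x0 j.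
  apply: (@ge0_of_quadratic _ _ _ (sq_ge0 x0)) => e e0 e1.
  have Kx : K (fun i => (1 - e) * x0 i) by apply: KZ => //; rewrite subr_ge0.
  have e2 : (fun i => (1 - e) * x0 i) = (fun i => x0 i + - e * x0 i).
    by apply/funext => i; ring.
  rewrite e2 in Kx; have Px := Phi_at _ x0 (- e) (fun j => Tlin x0 x0 (- e) j).
  by have := x0min _ Kx; rewrite Px lerDl sqrrN !mulrN mulNr.
have -> : \sum_j y j * b j = \sum_j y j * T x0 j - Phi x0.
  by rewrite /Phi -sumrB; apply: eq_bigr => j _; rewrite /y; ring.
have : 0 < Phi x0 by rewrite lt_neqAle eq_sym P0 sumr_ge0 // => j _; exact: sqr_ge0.
lra.
Qed.

End ConeAlternative.

Lemma sum_delta (R : pzRingType) (V : finType) (f : V -> R) u :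
  \sum_v f v * (v == u)%:R = f u.
Proof.
rewrite (bigD1 u) //= eqxx mulr1 big1 ?addr0 // => v /negbTE ->; exact: mulr0.
Qed.

Definition energy (R : pzRingType) (V : finType) (A : V -> V -> R) (x : V -> R) : R :=
  \sum_u \sum_v A u v * (x u - x v) ^+ 2.

(** * Positive semidefinite forms as Gram matrices *)

Section Gram.
Variables (R : rcfType) (V : finType).
Implicit Types (Y : V -> V -> R) (x z : V -> R).

Definition quad_form Y x : R := \sum_u \sum_v Y u v * (x u * x v).

Lemma quad_form_shift Y x u t : (forall a b, Y a b = Y b a) ->
  quad_form Y (fun v => x v + t * (v == u)%:R) =
  quad_form Y x + 2 * t * (\sum_v Y u v * x v) + t ^+ 2 * Y u u.
Proof.
move=> Ysym.
have row a c : \sum_b Y a b * (c * (x b + t * (b == u)%:R)) =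
    c * (\sum_b Y a b * x b) + c * t * Y a u.
  rewrite -(sum_delta (Y a) u) !mulr_sumr -big_split; apply: eq_bigr => b _ /=; ring.
rewrite /quad_form.
under eq_bigr => a _ do rewrite row.
under [in RHS]eq_bigr => a _.
  rewrite (_ : \sum_v _ = x a * (\sum_v Y a v * x v)); last first.
    by rewrite mulr_sumr; apply: eq_bigr => b _; ring.
  over.
rewrite (_ : \sum_a _ = \sum_a (x a * (\sum_v Y a v * x v)) +
   (t * (\sum_a (\sum_v Y a v * x v) * (a == u)%:R) +
   t * (\sum_a Y u a * x a) + t ^+ 2 * (\sum_a Y u a * (a == u)%:R))); last first.
  rewrite !mulr_sumr -!big_split; apply: eq_bigr => a _ /=.
  by rewrite (Ysym u a); ring.
by rewrite !sum_delta; ring.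
Qed.

(** Cholesky elimination, by induction on the number of nonzero diagonal entries. A pivot [u0]
    splits off one vector and leaves the Schur complement [Y']; with zero diagonal, positivity
    forces [Y = 0]. *)
Lemma psd_gram Y : (forall u v, Y u v = Y v u) -> (forall x, 0 <= quad_form Y x) ->
  exists ys : seq (V -> R), forall u v, Y u v = \sum_(y <- ys) y u * y v.
Proof.
have [n] := ubnP #|[set u | Y u u != 0]|.
elim: n Y => // n IHn Y; rewrite ltnS => Hn Ysym Ypsd.
have q0 : quad_form Y (fun=> 0) = 0.
  by rewrite /quad_form big1 // => u _; rewrite big1 // => v _; rewrite mulr0 mulr0.
have qdelta u t : quad_form Y (fun v => 0 + t * (v == u)%:R) = t ^+ 2 * Y u u.
  rewrite quad_form_shift // q0 (_ : \sum_v _ = 0) ?mulr0 ?add0r //.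
  by rewrite big1 // => v _; rewrite mulr0.
have diag_ge0 u : 0 <= Y u u.
  by have := Ypsd (fun v => 0 + 1 * (v == u)%:R); rewrite qdelta expr1n mul1r.
have [u0 Hu0|Ydiag] := pickP (fun u => Y u u != 0); last first.
  exists [::] => u v; rewrite big_nil.
  have h t : 0 <= 2 * t * Y u v.
    have := Ypsd (fun b => (0 + 1 * (b == v)%:R) + t * (b == u)%:R).
    rewrite quad_form_shift // qdelta.
    have /negbFE/eqP -> := Ydiag u; have /negbFE/eqP -> := Ydiag v.
    rewrite !mulr0 add0r addr0; congr (0 <= _ * _).
    under eq_bigr => b _ do rewrite add0r mul1r.
    exact: sum_delta.
  have h1 := h 1; have h2 := h (-1); lra.
pose p := Y u0 u0; have p0 : 0 < p by rewrite lt_neqAle eq_sym Hu0 diag_ge0.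
pose Y' u v := Y u v - Y u0 u * Y u0 v / p.
have Y'sym u v : Y' u v = Y' v u by rewrite /Y' Ysym; ring.
have Y'psd x : 0 <= quad_form Y' x.
  pose L := \sum_v Y u0 v * x v.
  (* The shift along [u0] that minimizes the form of [Y]; the minimum is the form of [Y'] at [x]. *)
  have := Ypsd (fun v => x v + - (L / p) * (v == u0)%:R); rewrite quad_form_shift // -/L -/p.
  congr (0 <= _).
  rewrite [RHS](_ : _ = quad_form Y x - L * L / p); first by field; rewrite gt_eqF.
  rewrite /L [in RHS]mulrAC [in RHS]mulr_suml [in RHS]mulr_suml /quad_form -sumrB.
  apply: eq_bigr => u _.
  rewrite [in RHS]mulr_sumr -sumrB; apply: eq_bigr => v _; rewrite /Y'; ring.
have [|//||ys Hys] := IHn Y'.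
- apply: leq_trans Hn; apply: proper_card; apply/properP; split.
    apply/fintype.subsetP => u; rewrite !inE; apply: contraNneq => Yu.
    have := Y'psd (fun v => 0 + 1 * (v == u)%:R).
    rewrite quad_form_shift // (_ : quad_form Y' _ = 0); last first.
      by rewrite /quad_form big1 // => a _; rewrite big1 // => b _; rewrite mulr0 mulr0.
    rewrite [X in _ + X + _](_ : _ = 0); last first.
      by rewrite big1 ?mulr0 // => v _; rewrite mulr0.
    rewrite expr1n mul1r !add0r /Y' Yu sub0r => h; rewrite eq_le oppr_le0 h andbT.
    by rewrite divr_ge0 ?(ltW p0) // -expr2 sqr_ge0.
  by exists u0; rewrite !inE // negbK /Y' -/p mulfK ?subrr // gt_eqF.
- by [].
exists ((fun v => Y u0 v / Num.sqrt p) :: ys) => u v.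
rewrite big_cons -Hys /Y'.
have sp : Num.sqrt p != 0 by rewrite gt_eqF // sqrtr_gt0.
have -> : Y u0 u / Num.sqrt p * (Y u0 v / Num.sqrt p) =
  Y u0 u * Y u0 v / (Num.sqrt p ^+ 2) by field.
by rewrite sqr_sqrtr ?ltW //; ring.
Qed.

End Gram.

(** * The conic program and its dual *)

Section Duality.
Variables (R : realType) (V : finType) (E : rel V) (w : V -> R) (lam : R).
Implicit Types (A B N Y : V -> V -> R).

(** A row of the signed incidence matrix. *)
Let inc (u v i : V) : R := (u == i)%:R - (v == i)%:R.

Lemma sum_inc (z : V -> R) u v : \sum_i z i * inc u v i = z u - z v.
Proof.
under eq_bigr do rewrite mulrBr (eq_sym u) (eq_sym v).
by rewrite sumrB !sum_delta.
Qed.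

Definition laplacian B i j : R := \sum_u \sum_v B u v * (inc u v i * inc u v j).

Lemma laplacian_form Y B :
  \sum_i \sum_j Y i j * laplacian B i j =
  \sum_u \sum_v B u v * (\sum_i \sum_j Y i j * (inc u v i * inc u v j)).
Proof.
under eq_bigr => i _ do under eq_bigr => j _ do
  (rewrite mulr_sumr; under eq_bigr => u _ do rewrite mulr_sumr).
under [RHS]eq_bigr => u _ do under eq_bigr => v _ do
  (rewrite mulr_sumr; under eq_bigr => i _ do rewrite mulr_sumr).
under eq_bigr => i _ do (rewrite exchange_big; under eq_bigr => u _ do rewrite exchange_big).
rewrite exchange_big; apply: eq_bigr => u _.
rewrite exchange_big; apply: eq_bigr => v _.
by apply: eq_bigr => i _; apply: eq_bigr => j _; ring.
Qed.

Lemma sum_gram_inc (ys : seq (V -> R)) u v :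
  \sum_i \sum_j (\sum_(y <- ys) y i * y j) * (inc u v i * inc u v j) =
  \sum_(y <- ys) (y u - y v) ^+ 2.
Proof.
under eq_bigr => i _ do under eq_bigr => j _ do rewrite mulr_suml.
under eq_bigr => i _ do rewrite exchange_big.
rewrite exchange_big; apply: eq_bigr => y _.
rewrite expr2 -sum_inc mulr_suml; apply: eq_bigr => i _.
rewrite mulr_sumr; apply: eq_bigr => j _; ring.
Qed.

Lemma laplacian_energy B z : quad_form (laplacian B) z = energy B z.
Proof.
rewrite /quad_form; under eq_bigr => i _ do under eq_bigr => j _ do rewrite mulrC.
rewrite laplacian_form; apply: eq_bigr => u _; apply: eq_bigr => v _.
have := sum_gram_inc [:: z] u v; rewrite big_seq1 => <-.
by congr (_ * _); apply: eq_bigr => i _; apply: eq_bigr => j _; rewrite big_seq1.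
Qed.

Let I : finType := ((V * V) + (V * V))%type.
Let J : finType := ((V * V) + (V + V))%type.

(* A point of the cone [K] consists of edge weights and of a positive semidefinite
   form; [T x = target] says that the form is the Laplacian of the edge weights
   minus [lam] times that of [w u * w v], and that all row and column sums of the
   weights are given by [w]. *)
Let edge (x : I -> R) u v := x (inl (u, v)).
Let form (x : I -> R) i j := x (inr (i, j)).

Let X := prod_topology (fun _ : I => R : topologicalType).

Let K : set X := fun x => [/\ forall u v, 0 <= edge x u v,
  forall u v, ~~ E u v -> edge x u v = 0 & forall z, 0 <= quad_form (form x) z].

Let T (x : X) (j : J) : R := match j with
  | inl p => form x p.1 p.2 - laplacian (edge x) p.1 p.2
  | inr (inl u) => \sum_v edge x u v
  | inr (inr v) => \sum_u edge x u v
  end.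

Let target (j : J) : R := match j with
  | inl p => - (lam * laplacian (fun u v => w u * w v) p.1 p.2)
  | inr (inl u) => w u
  | inr (inr v) => w v
  end.

Let pairing (y f : J -> R) : \sum_j y j * f j =
  \sum_i \sum_j y (inl (i, j)) * f (inl (i, j)) +
  (\sum_u y (inr (inl u)) * f (inr (inl u)) + \sum_v y (inr (inr v)) * f (inr (inr v))).
Proof.
rewrite big_sumType big_sumType /=; congr (_ + _).
by rewrite pair_bigA; apply: eq_bigr => -[i j].
Qed.

Let edge_cont u v : continuous (fun x : X => edge x u v).
Proof. exact: (@proj_continuous I (fun=> R) (inl (u, v))). Qed.

Let form_cont u v : continuous (fun x : X => form x u v).
Proof. exact: (@proj_continuous I (fun=> R) (inr (u, v))). Qed.


Let K_closed : closed K.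
Proof.
have -> : K = (\bigcap_p [set x : X | 0 <= edge x p.1 p.2] `&`
   (\bigcap_(p in [set p | ~~ E p.1 p.2]) [set x : X | edge x p.1 p.2 = 0] `&`
    \bigcap_z [set x : X | 0 <= quad_form (form x) z]))%classic.
  apply/seteqP; split => [x [h1 h2 h3] | x [h1 [h2 h3]]].
    by split => [p _|]; [exact: h1 | split => [p|z _]; [exact: h2 | exact: h3]].
  split => [u v|u v|z]; first exact: (h1 (u, v)).
    exact: (h2 (u, v)).
  exact: h3.
apply: closedI; last apply: closedI.
- by apply: closed_bigI => p _; apply: closed_ge0; exact: edge_cont.
- by apply: closed_bigI => p _; apply: closed_eq0; exact: edge_cont.
- apply: closed_bigI => z _; apply: closed_ge0.
  by do 2!apply: continuous_sum => ?; apply: continuous_mulr; exact: form_cont.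
Qed.

Let K_zero : K (fun=> 0).
Proof.
split=> // z; rewrite /quad_form; apply: sumr_ge0 => u _; apply: sumr_ge0 => v _.
by rewrite /form mul0r.
Qed.

Let K_scale (x : X) c : 0 <= c -> K x -> K (fun i => c * x i).
Proof.
move=> c0 [h1 h2 h3]; split => [u v|u v Euv|z].
- by apply: mulr_ge0 => //; exact: h1.
- by have := h2 u v Euv; rewrite /edge => ->; rewrite mulr0.
- have := mulr_ge0 c0 (h3 z); congr (0 <= _).
  rewrite /quad_form mulr_sumr; apply: eq_bigr => u _.
  rewrite mulr_sumr; apply: eq_bigr => v _; rewrite /form; ring.
Qed.

Let K_add (x k : X) : K x -> K k -> K (fun i => x i + k i).
Proof.
move=> [h1 h2 h3] [k1 k2 k3]; split => [u v|u v Euv|z].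
- by apply: addr_ge0; [exact: h1 | exact: k1].
- by have := h2 u v Euv; have := k2 u v Euv; rewrite /edge => -> ->; rewrite addr0.
- have := addr_ge0 (h3 z) (k3 z); congr (0 <= _).
  rewrite /quad_form -big_split; apply: eq_bigr => u _ /=.
  by rewrite -big_split; apply: eq_bigr => v _ /=; rewrite -mulrDl.
Qed.

Let T_linear (x k : X) c j : T (fun i => x i + c * k i) j = T x j + c * T k j.
Proof.
case: j => [[i j]|[u|v]] /=.
- rewrite /form mulrBr addrACA; congr (_ + _); rewrite -opprD mulr_sumr -big_split.
  congr (- _); apply: eq_bigr => u _; rewrite mulr_sumr -big_split; apply: eq_bigr => v _ /=.
  rewrite /edge; ring.
- by rewrite mulr_sumr -big_split.
- by rewrite mulr_sumr -big_split.
Qed.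

Let T_cont j : continuous (fun x : X => T x j).
Proof.
case: j => [[i j]|[u|v]] /=.
- apply: continuous_sub; first exact: form_cont.
  by do 2!apply: continuous_sum => ?; apply: continuous_mulr; exact: edge_cont.
- by apply: continuous_sum => v; exact: edge_cont.
- by apply: continuous_sum => u; exact: edge_cont.
Qed.

Let inc_le1 u v i : `|inc u v i| <= 1.
Proof.
rewrite /inc; case: (u == i); case: (v == i);
  by rewrite ?subrr ?subr0 ?sub0r ?normrN ?normr0 ?normr1.
Qed.

(** Nonnegative weights are controlled by their row sums; the form is its residual plus the
    Laplacian of the weights, whose entries are at most the total weight. *)
Let T_coercive (x : X) i : K x -> `|x i| <= 2 * \sum_j `|T x j|.
Proof.
move=> [h1 h2 h3]; set S := \sum_j _.
have S0 : 0 <= S by apply: sumr_ge0.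
have le_S j : `|T x j| <= S by rewrite /S (bigD1 j) //= lerDl sumr_ge0.
have edges : \sum_u \sum_v edge x u v <= S.
  rewrite /S !big_sumType /=; apply: le_trans (_ : \sum_u `|\sum_v edge x u v| <= _).
    by apply: ler_sum => u _; exact: ler_norm.
  rewrite addrCA lerDl addr_ge0 //; exact: sumr_ge0.
case: i => [[u v]|[i j]].
- rewrite -/(edge x u v) ger0_norm ?h1 //; apply: (@le_trans _ _ S); last by lra.
  apply: le_trans edges; apply: le_trans (_ : \sum_b edge x u b <= _).
    by rewrite (bigD1 v) //= lerDl sumr_ge0.
  by rewrite [leRHS](bigD1 u) //= lerDl sumr_ge0 // => a _; exact: sumr_ge0.
- have -> : x (inr (i, j)) = T x (inl (i, j)) + laplacian (edge x) i j by rewrite /= subrK.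
  apply: le_trans (ler_normD _ _) _; rewrite mulr_natl mulr2n lerD // ?le_S //.
  apply: le_trans edges; apply: le_trans (ler_norm_sum _ _ _) _; apply: ler_sum => u _.
  apply: le_trans (ler_norm_sum _ _ _) _; apply: ler_sum => v _.
  rewrite normrM ger0_norm ?h1 // -[leRHS]mulr1 ler_wpM2l ?h1 // normrM.
  by rewrite mulr_ile1.
Qed.

(** The two cases of [cone_alternative]. A separating [y] consists of a matrix [Y] and potentials
    [a], [b]; testing it on elements of the cone shows that [Y] is a Gram matrix and gives the edge
    constraints. *)
Lemma reweighting_duality :
  (exists2 A, feasible E w A &
     forall x, lam * energy (fun u v => w u * w v) x <= energy A x) \/
  (exists ys a b, (forall u v, E u v -> \sum_(y <- ys) (y u - y v) ^+ 2 <= a u + b v) /\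
     \sum_u w u * (a u + b u) <
     lam * \sum_u \sum_v w u * w v * \sum_(y <- ys) (y u - y v) ^+ 2).
Proof.
have [| |[x [h1 h2 h3] hT]|[y hK hy]] :=
  @cone_alternative R I J K T target 2 K_closed K_zero _ K_scale T_linear T_cont _ T_coercive.
- by move=> x k c c0 Kx Kk; apply: K_add => //; exact: K_scale.
- by [].
- left; exists (edge x).
    have out u := hT (inr (inl u)); have inn u := hT (inr (inr u)).
    by split => // u; rewrite ?[LHS]out ?[RHS]inn.
  move=> z; rewrite -!laplacian_energy -subr_ge0.
  have := h3 z; congr (0 <= _); rewrite /quad_form mulr_sumr -sumrB; apply: eq_bigr => i _.
  rewrite mulr_sumr -sumrB; apply: eq_bigr => j _.
  have := hT (inl (i, j)); rewrite /= => /(canRL (subrK _)) ->; ring.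
right; pose Y i j := y (inl (i, j)).
pose a u := y (inr (inl u)); pose b v := y (inr (inr v)).
pose D u v := \sum_i \sum_j Y i j * (inc u v i * inc u v j).
have pairT (k : X) : \sum_j y j * T k j = \sum_i \sum_j Y i j * form k i j
   - \sum_u \sum_v edge k u v * D u v + \sum_u \sum_v edge k u v * (a u + b v).
  rewrite pairing -laplacian_form -sumrB; congr (_ + _).
    by apply: eq_bigr => i _; rewrite -sumrB; apply: eq_bigr => j _; rewrite mulrBr.
  under [X in _ + X]eq_bigr do rewrite mulr_sumr.
  rewrite [X in _ + X]exchange_big -big_split; apply: eq_bigr => u _ /=.
  rewrite mulr_sumr -big_split; apply: eq_bigr => v _ /=.
  by rewrite /a /b /edge; ring.
have form_test N : (forall z, 0 <= quad_form N z) -> 0 <= \sum_i \sum_j Y i j * N i j.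
  move=> N0; pose k : X := fun i => if i is inr p then N p.1 p.2 else 0.
  have /hK : K k by split.
  rewrite pairT [X in _ - X + _]big1 ?subr0; last first.
    by move=> u _; rewrite big1 // => v _; rewrite mul0r.
  by rewrite [X in _ + X]big1 ?addr0 // => u _; rewrite big1 // => v _; rewrite mul0r.
(* An antisymmetric matrix and its negative both have zero quadratic form, so both lie in the
   cone. *)
have Ysym u v : Y u v = Y v u.
  have h u0 v0 : Y v0 u0 <= Y u0 v0.
    have := form_test (fun i j => (i == u0)%:R * (j == v0)%:R - (i == v0)%:R * (j == u0)%:R).
    have e N : \sum_i \sum_j N i j *
        ((i == u0)%:R * (j == v0)%:R - (i == v0)%:R * (j == u0)%:R) = N u0 v0 - N v0 u0.
      rewrite -(sum_delta (N^~ v0) u0) -(sum_delta (N^~ u0) v0) -sumrB; apply: eq_bigr => i _.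
      rewrite -(sum_delta (N i) v0) -(sum_delta (N i) u0) !mulr_suml -sumrB; apply: eq_bigr => j _.
      ring.
    rewrite e subr_ge0; apply => z; rewrite /quad_form.
    under eq_bigr => i _ do under eq_bigr => j _ do rewrite mulrC.
    by rewrite e mulrC subrr.
  by apply/eqP; rewrite eq_le !h.
have [|ys Hys] := @psd_gram R V Y Ysym.
  move=> z; have := form_test (fun i j => z i * z j); apply => t.
  have -> : quad_form (fun i j => z i * z j) t = (\sum_i z i * t i) ^+ 2.
    rewrite expr2 mulr_suml; apply: eq_bigr => i _; rewrite mulr_sumr.
    by apply: eq_bigr => j _; ring.
  exact: sqr_ge0.
have DE u v : D u v = \sum_(y <- ys) (y u - y v) ^+ 2.
  by rewrite -sum_gram_inc; apply: eq_bigr => i _; apply: eq_bigr => j _; rewrite Hys.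
exists ys, a, b; split => [u v Euv|].
  (* Unit weight on the single edge [uv] isolates its dual constraint. *)
  pose k : X := fun i => if i is inl p then (p.1 == u)%:R * (p.2 == v)%:R else 0.
  have Kk : K k.
    split => [i j|i j|z]; rewrite /edge /k /=; first by rewrite mulr_ge0.
      by have [->|] := eqVneq i u; have [->|] := eqVneq j v; rewrite ?Euv ?mul0r ?mulr0.
    by rewrite /quad_form sumr_ge0 // => i _; rewrite sumr_ge0 // => j _; rewrite mul0r.
  have e N : \sum_i \sum_j edge k i j * N i j = N u v.
    rewrite -(sum_delta (N^~ v) u); apply: eq_bigr => i _.
    rewrite -(sum_delta (N i) v) mulr_suml; apply: eq_bigr => j _.
    by rewrite /edge /k /=; ring.
  have := hK _ Kk; rewrite pairT !e [X in X - _ + _]big1 ?sub0r -?DE; first by lra.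
  by move=> i _; rewrite big1 // => j _; rewrite mulr0.
move: hy; rewrite pairing.
under eq_bigr => i _ do under eq_bigr => j _ do rewrite /= mulrN mulrCA.
have -> : \sum_i \sum_j - (lam * (y (inl (i, j)) * laplacian (fun u v => w u * w v) i j)) =
   - (lam * \sum_u \sum_v w u * w v * D u v).
  rewrite -laplacian_form mulr_sumr -sumrN; apply: eq_bigr => i _.
  by rewrite mulr_sumr -sumrN.
rewrite addrC subr_lt0 /= -big_split; congr (_ < _).
  by apply: eq_bigr => u _ /=; rewrite /a /b; ring.
by congr (_ * _); apply: eq_bigr => u _; apply: eq_bigr => v _; rewrite DE.
Qed.

End Duality.

(** * The second eigenvalue of a symmetric matrix *)

Lemma mup_prod_XsubC (F : fieldType) (s : seq F) x :
  mup x (\prod_(a <- s) ('X - a%:P)) = count_mem x s.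
Proof.
elim: s => [|a s IH] /=; first by rewrite big_nil mupNroot // rootC oner_eq0.
rewrite big_cons mupM ?polyXsubC_eq0 //; last first.
  by apply/monic_neq0/monic_prod_XsubC.
rewrite IH; congr addn; have := mup_XsubCX 1 x a; rewrite expr1 => ->.
by rewrite eq_sym; case: eqP.
Qed.

Section Eigenvalues.
Variables (R : realType) (n : nat) (M : 'M[R]_n) (s : seq R).
Hypothesis char_poly_split : char_poly M = \prod_(a <- s) ('X - a%:P).

Lemma perm_eigenvalues : perm_eq (eigenvalues M) s.
Proof.
have p0 : char_poly M != 0 by apply/monic_neq0/char_poly_monic.
apply/allP => x _ /=; rewrite -(mup_prod_XsubC s) -char_poly_split.
rewrite /eigenvalues count_flatten -map_comp sumnE big_map /=.
under eq_bigr => y _ do rewrite /= count_nseq.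
have [xr|xr] := boolP (x \in rootsR (char_poly M)).
  rewrite (bigD1_seq x) //= ?eqxx ?mul1n; last exact: uniq_roots.
  by rewrite big1 ?addn0 // => y /negbTE ->.
have -> : mup x (char_poly M) = 0%N.
  apply: mupNroot; apply: contra xr => rx.
  by rewrite -(roots_on_rootsR p0) ?inE.
rewrite big1_seq // => y /andP[_ yr] /=; have [yx|] := eqVneq y x; last by rewrite mul0n.
by rewrite -yx yr in xr.
Qed.

Lemma sorted_eigenvalues : sorted <=%R (eigenvalues M).
Proof.
set p := char_poly M.
rewrite /eigenvalues; have := sorted_roots (- cauchy_bound p) (cauchy_bound p) p.
rewrite -/(rootsR _) !sorted_pairwise; try exact: le_trans; try exact: lt_trans.
elim: (rootsR _) => //= x r IH /andP[xr /IH Hr].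
rewrite pairwise_cat Hr andbT; apply/andP; split.
  apply/allrelP => a b /nseqP[-> _] /flattenP[t /mapP[y yr ->]] /nseqP[-> _].
  by move/allP: xr => /(_ _ yr) /ltW.
by elim: (mup _ _) => //= k ->; rewrite andbT; apply/allP => y /nseqP[->].
Qed.

End Eigenvalues.

(** [d] lists the spectrum in arbitrary order. Counting with multiplicity, at least two entries are
    at most the second smallest and at most one is strictly below it. *)
Lemma lambda2_split (R : realType) (n : nat) (M : 'M[R]_n) (d : 'I_n -> R) :
  (1 < n)%N -> char_poly M = \prod_i ('X - (d i)%:P) ->
  (exists i j, [/\ i != j, d i <= lambda2 M & d j <= lambda2 M]) /\
  (exists i, forall j, j != i -> lambda2 M <= d j).
Proof.
move=> n1 Hc; have Hs : char_poly M = \prod_(a <- [seq d i | i <- enum 'I_n]) ('X - a%:P).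
  by rewrite big_map big_enum.
have Hp := perm_eigenvalues Hs; have := sorted_eigenvalues M.
have := perm_size Hp; rewrite size_map size_enum_ord /lambda2.
have cnt (a : pred R) : count a (eigenvalues M) = #|[pred i | a (d i)]|.
  rewrite (permP Hp) count_map -size_filter cardE /enum_mem -filter_predI.
  by congr size; apply: eq_filter => i; rewrite /= andbT.
move: cnt; case: (eigenvalues M) => [|x [|y t]] /= cnt szn.
- by rewrite -szn in n1.
- by rewrite -szn in n1.
move=> /andP[xy]; rewrite (path_sortedE le_trans) => /andP[/allP yt _].
split.
  have : (1 < #|[pred i | (d i <= y)%R]|)%N by have := cnt (fun z => z <= y); rewrite xy lexx => <-.
  by move=> /card_gt1P[i [j [hi hj ij]]]; exists i, j.
have : (#|[pred i | (d i < y)%R]| <= 1)%N.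
  have := cnt (fun z => z < y); rewrite ltxx add0n => <-; have -> : count (fun z => z < y) t = 0%N.
    by apply/eqP; rewrite eqn0Ngt -has_count; apply/hasPn => z /yt; rewrite leNgt.
  by rewrite addn0; case: (_ < _).
move=> /card_le1_eqP h.
have [i0 Hi0|Hn] := pickP [pred i | (d i < y)%R].
  exists i0 => j ji; rewrite leNgt; apply/negP => dj; move/eqP: ji; apply.
  by apply: h.
exists (Ordinal (ltnW n1)) => j _; rewrite leNgt; apply/negbT; exact: Hn.
Qed.

Lemma char_poly_conj (F : fieldType) n (P D : 'M[F]_n) : P \in unitmx ->
  char_poly (invmx P *m D *m P) = char_poly D.
Proof.
move=> Pu; rewrite /char_poly.
have PP : map_mx polyC (invmx P) *m map_mx polyC P = 1%:M.
  by rewrite -map_mxM mulVmx // map_mx1.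
have -> : char_poly_mx (invmx P *m D *m P) =
    map_mx polyC (invmx P) *m char_poly_mx D *m map_mx polyC P.
  rewrite /char_poly_mx mulmxBr mulmxBl !map_mxM -scalemx1 -scalemxAr mulmx1 -scalemxAl PP.
  by [].
rewrite !det_mulmx mulrAC -det_mulmx PP det1 mul1r //.
Qed.

Lemma conj_conjc (R : rcfType) (z : R[i]) : Num.conj z = conjc z.
Proof. by []. Qed.

Section Spectral.
Variables (R : rcfType) (n : nat).
Local Notation C := R[i].
Local Notation rc := (real_complex R).

Definition mx_form (N : 'M[R]_n) (y : 'rV[R]_n) : R := (y *m N *m y^T) 0 0.

Lemma mx_formE N y : mx_form N y = \sum_i \sum_j N i j * (y 0 i * y 0 j).
Proof.
rewrite /mx_form mxE exchange_big; apply: eq_bigr => j _; rewrite !mxE mulr_suml.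
by apply: eq_bigr => i _; ring.
Qed.

Definition re_mx (x : 'rV[C]_n) : 'rV[R]_n := map_mx (@complex.Re R) x.
Definition im_mx (x : 'rV[C]_n) : 'rV[R]_n := map_mx (@complex.Im R) x.

Lemma Re_sum (I : finType) (F : I -> C) : complex.Re (\sum_i F i) = \sum_i complex.Re (F i).
Proof.
elim: (index_enum I) => [|i r IH]; rewrite ?big_nil // !big_cons -IH.
by case: (F i) (\sum_(j <- r) F j) => a b [c e].
Qed.

Lemma Im_sum (I : finType) (F : I -> C) : complex.Im (\sum_i F i) = \sum_i complex.Im (F i).
Proof.
elim: (index_enum I) => [|i r IH]; rewrite ?big_nil // !big_cons -IH.
by case: (F i) (\sum_(j <- r) F j) => a b [c e].
Qed.

Lemma re_mul m (x : 'rV[C]_n) (N : 'M[R]_(n, m)) :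
  re_mx x *m N = map_mx (@complex.Re R) (x *m map_mx rc N).
Proof.
apply/matrixP => a b; rewrite !mxE Re_sum; apply: eq_bigr => k _; rewrite !mxE.
by case: (x a k) => r i /=; ring.
Qed.

Lemma im_mul m (x : 'rV[C]_n) (N : 'M[R]_(n, m)) :
  im_mx x *m N = map_mx (@complex.Im R) (x *m map_mx rc N).
Proof.
apply/matrixP => a b; rewrite !mxE Im_sum; apply: eq_bigr => k _; rewrite !mxE.
by case: (x a k) => r i /=; ring.
Qed.

(* The imaginary part of [x *m N *m x^*] vanishes as [N] is symmetric. *)
Lemma mx_form_complex N (x : 'rV[C]_n) :
  mx_form N (re_mx x) + mx_form N (im_mx x) =
  complex.Re ((x *m map_mx rc N *m map_mx Num.conj x^T) 0 0).
Proof.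
rewrite !mx_formE -big_split /=.
under eq_bigr => i _ do rewrite -big_split /=.
rewrite exchange_big [in RHS]mxE Re_sum; apply: eq_bigr => j _.
rewrite [in RHS]mxE mulr_suml Re_sum; apply: eq_bigr => i _; rewrite !mxE conj_conjc.
by case: (x 0 i) (x 0 j) => a b [c e] /=; ring.
Qed.

(* The eigenbasis is taken over the complex numbers, where the spectral theorem is
   available; complex vectors enter through their real and imaginary parts. *)
Lemma symmetric_spectral (M : 'M[R]_n) : M^T = M ->
  exists (P : 'M[C]_n) (d : 'I_n -> R),
  [/\ P \in unitmx, char_poly M = \prod_i ('X - (d i)%:P)
    & forall c : 'rV[C]_n, let x := c *m P in
      let sqnorm i := complex.Re (c 0 i) ^+ 2 + complex.Im (c 0 i) ^+ 2 in
      mx_form M (re_mx x) + mx_form M (im_mx x) = \sum_i d i * sqnorm i /\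
      mx_form 1%:M (re_mx x) + mx_form 1%:M (im_mx x) = \sum_i sqnorm i].
Proof.
move=> Msym; pose A := map_mx rc M.
have Areal : A \is a mxOver Num.real.
  by apply/mxOverP => i j; rewrite mxE complex_real.
have Aherm : A \is hermsymmx.
  apply: realsym_hermsym => //; apply/is_hermitianmxP.
  by rewrite expr0 scale1r map_mx_id // /A map_trmx Msym.
have /orthomx_spectralP A_eq := hermitian_normalmx Aherm.
set P := spectralmx A in A_eq; set D := spectral_diag A in A_eq.
have Punitary : P \is unitarymx := spectral_unitarymx A.
have Punit : P \in unitmx := spectral_unit A.
pose d i := complex.Re (D 0 i).
have dE i : D 0 i = rc (d i).
  rewrite RRe_real //; have /mxOverP := hermitian_spectral_diag_real Aherm; exact.
have PPt : P *m map_mx Num.conj P^T = 1%:M by apply/unitarymxP.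
have norms (z : C) : complex.Re (z * Num.conj z) = complex.Re z ^+ 2 + complex.Im z ^+ 2.
  by rewrite conj_conjc; case: z => a b /=; ring.
exists P, d; split => // [|c x sqnorm].
- apply: (map_poly_inj rc); rewrite map_char_poly -/A A_eq char_poly_conj //.
  rewrite char_poly_trig; last first.
    by apply/is_trig_mxP => i j ij; rewrite mxE lt_eqF.
  rewrite rmorph_prod; apply: eq_bigr => i _.
  by rewrite rmorphB /= map_polyX map_polyC /= mxE eqxx dE.
- have ct : map_mx Num.conj x^T = map_mx Num.conj P^T *m map_mx Num.conj c^T.
    by rewrite trmx_mul map_mxM.
  split.
  + rewrite mx_form_complex -/A A_eq ct !mulmxA mulmxK //.
    rewrite -[c *m _ *m P *m _]mulmxA PPt mulmx1 mxE Re_sum; apply: eq_bigr => i _.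
    rewrite mul_mx_diag !mxE dE conj_conjc /sqnorm.
    by case: (c 0 i) => a b /=; ring.
  + rewrite mx_form_complex map_mx1 mulmx1 ct mulmxA -[c *m _ *m _]mulmxA PPt mulmx1.
    by rewrite mxE Re_sum; apply: eq_bigr => i _; rewrite !mxE norms.
Qed.

End Spectral.

(** * Courant-Fischer bounds for the second eigenvalue *)

Section Rayleigh.
Variables (R : realType) (n : nat) (M : 'M[R]_n) (mu : R).
Hypothesis n_gt1 : (1 < n)%N.
Hypothesis M_sym : M^T = M.
Local Notation rc := (real_complex R).

Lemma sqnorm_gt0 (z : R[i]) : z != 0 -> 0 < complex.Re z ^+ 2 + complex.Im z ^+ 2.
Proof.
case: z => a b; rewrite eq_complex /= negb_and => ab.
rewrite lt_neqAle eq_sym paddr_eq0 ?sqr_ge0 // !sqrf_eq0 negb_and ab.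
by rewrite addr_ge0 ?sqr_ge0.
Qed.

(** The plane of two eigenvectors with eigenvalues at most [lambda2 M] meets the orthogonal
    complement of [x0] in a nonzero vector. As [x0] is real, both real and imaginary parts of that
    vector are orthogonal to it. *)
Lemma lambda2_ge (x0 : 'rV[R]_n) :
  (forall x, x *m x0^T = 0 -> mu * mx_form 1%:M x <= mx_form M x) -> mu <= lambda2 M.
Proof.
move=> Hmu; have [P [d [Pu Hchar Hform]]] := symmetric_spectral M_sym.
have [[i [j [ij di dj]]] _] := lambda2_split n_gt1 Hchar.
pose g := P *m map_mx rc x0^T.
have [al [be [gab ab0]]] : exists al be, al * g i 0 + be * g j 0 = 0 /\ (al != 0) || (be != 0).
  have [gi|gi] := eqVneq (g i 0) 0.
    by exists 1, 0; rewrite gi mulr0 mul0r addr0 oner_eq0.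
  by exists (g j 0), (- g i 0); rewrite mulNr mulrC subrr oppr_eq0 gi orbT.
pose c : 'rV[R[i]]_n := al *: delta_mx 0 i + be *: delta_mx 0 j.
have cE k : c 0 k = al * (k == i)%:R + be * (k == j)%:R by rewrite !mxE.
have xx0 : c *m P *m map_mx rc x0^T = 0.
  by apply/matrixP => a b; rewrite !ord1 -mulmxA mulmxDl -!scalemxAl -!rowE [RHS]mxE -[RHS]gab !mxE.
have [qM q1] := Hform c; set x := c *m P in xx0 qM q1.
pose rho k := complex.Re (c 0 k) ^+ 2 + complex.Im (c 0 k) ^+ 2.
have rho_ge0 k : 0 <= rho k by rewrite addr_ge0 ?sqr_ge0.
have rho0 k : d k * rho k <= lambda2 M * rho k.
  have [->|ki] := eqVneq k i; first by rewrite ler_wpM2r.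
  have [->|kj] := eqVneq k j; first by rewrite ler_wpM2r.
  by rewrite /rho cE (negbTE ki) (negbTE kj) !mulr0 addr0 expr0n addr0 !mulr0.
have rho_gt0 : 0 < \sum_k rho k.
  have pos k : c 0 k != 0 -> 0 < \sum_k rho k.
    by move=> /sqnorm_gt0 ck; rewrite (bigD1 k) //= ltr_wpDr // sumr_ge0.
  case/orP: ab0 => h; [apply: (pos i) | apply: (pos j)]; rewrite cE eqxx.
    by rewrite (negbTE ij) mulr1 mulr0 addr0.
  by rewrite (eq_sym j i) (negbTE ij) mulr1 mulr0 add0r.
have re0 : re_mx x *m x0^T = 0.
  by rewrite re_mul xx0; apply/matrixP => a b; rewrite !mxE.
have im0 : im_mx x *m x0^T = 0.
  by rewrite im_mul xx0; apply/matrixP => a b; rewrite !mxE.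
have := lerD (Hmu _ re0) (Hmu _ im0); rewrite -mulrDr qM q1 => h.
rewrite -(ler_pM2r rho_gt0); apply: le_trans h _; rewrite mulr_sumr.
exact: ler_sum.
Qed.

(** Some nonzero complex combination of [x1] and [x2] has no component along the eigenvector [i0];
    all other eigenvalues are at least [lambda2 M]. *)
Lemma lambda2_le (x1 x2 : 'rV[R]_n) :
  (forall al be, al *: x1 + be *: x2 = 0 -> al = 0 /\ be = 0) ->
  (forall al be, mx_form M (al *: x1 + be *: x2) <= mu * mx_form 1%:M (al *: x1 + be *: x2)) ->
  lambda2 M <= mu.
Proof.
move=> free Hmu; have [P [d [Pu Hchar Hform]]] := symmetric_spectral M_sym.
have [_ [i0 di0]] := lambda2_split n_gt1 Hchar.
pose g (x : 'rV[R]_n) := (map_mx rc x *m invmx P) 0 i0.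
have [al [be [gab ab0]]] : exists al be, al * g x1 + be * g x2 = 0 /\ (al != 0) || (be != 0).
  have [gi|gi] := eqVneq (g x1) 0.
    by exists 1, 0; rewrite gi mulr0 mul0r addr0 oner_eq0.
  by exists (g x2), (- g x1); rewrite mulNr mulrC subrr oppr_eq0 gi orbT.
pose x : 'rV[R[i]]_n := al *: map_mx rc x1 + be *: map_mx rc x2.
pose c := x *m invmx P.
have [qM q1] := Hform c; rewrite /= /c mulmxKV // -/c in qM q1.
have c0 : c 0 i0 = 0.
  by rewrite /c mulmxDl -!scalemxAl -[RHS]gab /g !mxE.
have rex : re_mx x = complex.Re al *: x1 + complex.Re be *: x2.
  by apply/rowP => k; rewrite !mxE; case: (al) (be) => a b [a' b'] /=; ring.
have imx : im_mx x = complex.Im al *: x1 + complex.Im be *: x2.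
  by apply/rowP => k; rewrite !mxE; case: (al) (be) => a b [a' b'] /=; ring.
pose rho k := complex.Re (c 0 k) ^+ 2 + complex.Im (c 0 k) ^+ 2.
have rho_ge0 k : 0 <= rho k by rewrite addr_ge0 ?sqr_ge0.
have rho_gt0 : 0 < \sum_k rho k.
  rewrite lt_neqAle eq_sym sumr_ge0 // andbT psumr_eq0 //; apply/negP => /allP h.
  have cz : c = 0.
    apply/rowP => k; rewrite [RHS]mxE; apply/eqP; apply: contraT => /sqnorm_gt0.
    by rewrite lt_neqAle eq_sym; have := h k; rewrite mem_index_enum => /(_ isT) /= ->.
  have xz : x = 0 by rewrite -[x](mulmxKV Pu) -/c cz mul0mx.
  have r0 : re_mx x = 0 by rewrite xz; apply/rowP => k; rewrite !mxE.
  have i0' : im_mx x = 0 by rewrite xz; apply/rowP => k; rewrite !mxE.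
  have [a1 b1] := free _ _ (etrans (esym rex) r0).
  have [a2 b2] := free _ _ (etrans (esym imx) i0').
  by move: ab0; rewrite !eq_complex /= a1 b1 a2 b2 !eqxx.
have := lerD (Hmu (complex.Re al) (complex.Re be)) (Hmu (complex.Im al) (complex.Im be)).
rewrite -rex -imx -mulrDr qM q1 => h.
rewrite -(ler_pM2r rho_gt0); apply: le_trans h; rewrite mulr_sumr.
apply: ler_sum => k _; have [->|ki] := eqVneq k i0.
  by rewrite /rho c0 expr0n addr0 !mulr0.
by rewrite ler_wpM2r // di0.
Qed.

End Rayleigh.

(** * Energy and cuts of a reweighting *)

Lemma mx_form1E (R : rcfType) n (x : 'rV[R]_n) : mx_form 1%:M x = \sum_i x 0 i ^+ 2.
Proof. by rewrite /mx_form mulmx1 mxE; apply: eq_bigr => i _; rewrite mxE expr2. Qed.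

Section Laplacian.
Variables (R : realType) (V : finType) (E : rel V) (w : V -> R) (A : V -> V -> R).
Hypothesis w_ge0 : forall v, 0 <= w v.
Hypothesis A_feas : feasible E w A.

Let A_ge0 u v : 0 <= A u v. Proof. by case: A_feas. Qed.
Let A_row u : \sum_v A u v = w u. Proof. by case: A_feas. Qed.
Let A_col v : \sum_u A u v = w v. Proof. by case: A_feas => _ _ <- ->. Qed.

Lemma feasible_le u v : A u v <= w u /\ A u v <= w v.
Proof.
split; first by rewrite -A_row (bigD1 v) //= lerDl sumr_ge0.
by rewrite -A_col (bigD1 u) //= lerDl sumr_ge0.
Qed.

Lemma normalized_laplacian_sym : (normalized_laplacian w A)^T = normalized_laplacian w A.
Proof.
rewrite /normalized_laplacian linearB /= trmx1 !trmx_mul /inv_sqrt_weight !tr_diag_mx.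
by rewrite linearZ /= linearD /= trmxK [X in _ *: X]addrC mulmxA.
Qed.

Lemma energyE (x : V -> R) :
  energy A x = 2 * (\sum_v w v * x v ^+ 2) - 2 * \sum_u \sum_v A u v * (x u * x v).
Proof.
rewrite (_ : energy A x = \sum_u \sum_v A u v * x u ^+ 2 + \sum_u \sum_v A u v * x v ^+ 2
   - 2 * \sum_u \sum_v A u v * (x u * x v)).
  rewrite [X in _ + X - _]exchange_big /=.
  have -> : \sum_u \sum_v A u v * x u ^+ 2 = \sum_v w v * x v ^+ 2.
    by apply: eq_bigr => u _; rewrite -mulr_suml A_row.
  have -> : \sum_v \sum_u A u v * x v ^+ 2 = \sum_v w v * x v ^+ 2.
    by apply: eq_bigr => u _; rewrite -mulr_suml A_col.
  by ring.
rewrite mulr_sumr -big_split -sumrB; apply: eq_bigr => u _ /=.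
rewrite mulr_sumr -big_split -sumrB; apply: eq_bigr => v _ /=; ring.
Qed.

(* [unscale x v = 0] when [w v = 0]. *)
Definition unscale (x : 'rV[R]_#|V|) v : R := (Num.sqrt (w v))^-1 * x 0 (enum_rank v).

(** The first sum is supported on the zeros of [w], where the matrix acts as the identity. *)
Lemma form_laplacian (x : 'rV[R]_#|V|) :
  mx_form (normalized_laplacian w A) x =
  \sum_v (x 0 (enum_rank v) ^+ 2 - w v * unscale x v ^+ 2) + 2^-1 * energy A (unscale x).
Proof.
have en (F : 'I_#|V| -> R) : \sum_i F i = \sum_v F (enum_rank v).
  by rewrite (reindex enum_rank) //; exact: onW_bij (@enum_rank_bij V).
have -> : mx_form (normalized_laplacian w A) x =
   \sum_v x 0 (enum_rank v) ^+ 2 - \sum_u \sum_v A u v * (unscale x u * unscale x v).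
  have sym : \sum_u \sum_v A u v * (unscale x u * unscale x v) =
      \sum_u \sum_v 2^-1 * (A u v + A v u) * (unscale x u * unscale x v).
    rewrite [RHS](_ : _ = 2^-1 * (\sum_u \sum_v A u v * (unscale x u * unscale x v)) +
       2^-1 * (\sum_u \sum_v A v u * (unscale x v * unscale x u))).
      by rewrite [X in _ + _ * X]exchange_big /=; field.
    rewrite !mulr_sumr -big_split; apply: eq_bigr => u _ /=.
    by rewrite !mulr_sumr -big_split; apply: eq_bigr => v _ /=; ring.
  rewrite sym -(en (fun i => x 0 i ^+ 2)) -mx_form1E /mx_form /normalized_laplacian.
  rewrite mulmxBr mulmxBl [LHS]mxE [X in _ + X = _]mxE; congr (_ - _).
  rewrite -/(mx_form _ _) mx_formE en; apply: eq_bigr => u _; rewrite en; apply: eq_bigr => v _.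
  rewrite /inv_sqrt_weight mul_mx_diag mxE mul_diag_mx !mxE !enum_rankK /unscale; ring.
by rewrite energyE sumrB; field.
Qed.

Lemma unscale_sqr x v : w v * unscale x v ^+ 2 <= x 0 (enum_rank v) ^+ 2.
Proof.
rewrite /unscale exprMn mulrA exprVn sqr_sqrtr //.
have [->|w0] := eqVneq (w v) 0; first by rewrite !mul0r sqr_ge0.
by rewrite mulfV // mul1r.
Qed.

(** For [x] orthogonal to [sqrt w], the energy of the product weights is [2 * \sum_v w v] times the
    weighted square norm of [unscale w x]. The bound [lam <= 1] handles the coordinates where [w]
    vanishes. *)
Lemma lambda2_ge_energy (lam : R) : (1 < #|V|)%N -> 0 <= lam <= 1 ->
  (forall x, lam * energy (fun u v => w u * w v) x <= (\sum_v w v) * energy A x) ->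
  0 < \sum_v w v -> lam <= lambda2 (normalized_laplacian w A).
Proof.
move=> V1 /andP[l0 l1] h W0.
apply: (@lambda2_ge _ _ _ _ V1 normalized_laplacian_sym (\row_i Num.sqrt (w (enum_val i)))).
move=> x /matrixP /(_ 0 0); rewrite !mxE.
under eq_bigr => i _ do rewrite !mxE.
rewrite (reindex enum_rank) /=; last by exact: onW_bij (@enum_rank_bij V).
under eq_bigr => i _ do rewrite enum_rankK.
move=> x0; rewrite mx_form1E form_laplacian.
rewrite (reindex enum_rank) /=; last by exact: onW_bij (@enum_rank_bij V).
have y0 : \sum_v w v * unscale x v = 0.
  rewrite -[RHS]x0; apply: eq_bigr => v _; rewrite /unscale.
  have [w0|w0] := eqVneq (w v) 0; first by rewrite w0 sqrtr0 mul0r mulr0.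
  rewrite -{1}[w v]sqr_sqrtr //; field.
  by rewrite gt_eqF // sqrtr_gt0 lt_neqAle eq_sym w0 w_ge0.
have eW : energy (fun u v => w u * w v) (unscale x) =
    2 * (\sum_v w v) * \sum_v w v * unscale x v ^+ 2.
  set y := unscale x in y0 *; set W := \sum_v w v; set Q := \sum_v _ * _ ^+ 2.
  have -> : energy (fun u v => w u * w v) y = \sum_u (w u * y u ^+ 2 * W + w u * Q).
    apply: eq_bigr => u _.
    transitivity (w u * y u ^+ 2 * W + w u * Q - 2 * w u * y u * \sum_v w v * y v).
      by rewrite /W /Q !mulr_sumr -big_split -sumrB; apply: eq_bigr => v _ /=; ring.
    by rewrite y0 mulr0 subr0.
  by rewrite big_split /= -!mulr_suml -/Q -/W; ring.
have := h (unscale x); rewrite eW => hx.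
have {hx} : lam * (\sum_v w v * unscale x v ^+ 2) <= 2^-1 * energy A (unscale x).
  rewrite -(ler_pM2l W0); lra.
set Q := \sum_v _ * _ ^+ 2; rewrite sumrB -/Q.
have QS : Q <= \sum_v x 0 (enum_rank v) ^+ 2 by apply: ler_sum => v _; exact: unscale_sqr.
move: QS; set S := \sum_v _; move=> QS hx; nra.
Qed.

End Laplacian.

(** * The flow across a cut *)

Section Cut.
Variables (R : realType) (V : finType) (E : rel V) (w : V -> R) (A : V -> V -> R).
Hypothesis w_ge0 : forall v, 0 <= w v.
Hypothesis A_feas : feasible E w A.

Let A_ge0 u v : 0 <= A u v. Proof. by case: A_feas. Qed.
Let A_row u : \sum_v A u v = w u. Proof. by case: A_feas. Qed.
Let A_col v : \sum_u A u v = w v. Proof. by case: A_feas => _ _ <- ->. Qed.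

Definition cut_flow (S : {set V}) : R := \sum_(u in S) \sum_(v in ~: S) A u v.

(** All flow leaving [S] enters out-neighbours, and each vertex [v] receives [w v] in total. *)
Lemma cut_flow_le S : cut_flow S <= weight w (out_neighbours E S).
Proof.
rewrite /cut_flow exchange_big /weight big_mkcond [leRHS]big_mkcond.
apply: ler_sum => v _ /=; rewrite finset.in_setC.
have [vb|vb] := boolP (v \in out_neighbours E S).
  case: ifP => _; last exact: w_ge0.
  by rewrite -A_col [leLHS]big_mkcond ler_sum // => u _; case: ifP.
case: ifP => // vS; rewrite big1 // => u uS; case: A_feas => _ A0 _ _; apply: A0.
by apply: contra vb => Euv; rewrite inE vS; apply/exists_inP; exists u.
Qed.

(** Sum the Eulerian condition over [S]; the flow inside [S] cancels. *)
Lemma cut_flow_balanced S : cut_flow (~: S) = cut_flow S.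
Proof.
have split_sum (f : V -> R) : \sum_v f v = \sum_(v in S) f v + \sum_(v in ~: S) f v.
  rewrite (bigID (mem S)) /=; congr (_ + _); apply: eq_bigl => v.
  by rewrite finset.in_setC.
have : \sum_(u in S) \sum_v A u v = \sum_(u in S) \sum_v A v u.
  by apply: eq_bigr => u _; rewrite A_row A_col.
under eq_bigr => u _ do rewrite split_sum.
under [RHS]eq_bigr => u _ do rewrite split_sum.
rewrite !big_split /= [X in X + _ = _]exchange_big => /addrI h.
by rewrite /cut_flow finset.setCK exchange_big h.
Qed.

Lemma energy_cut (S : {set V}) (al be : R) :
  energy A (fun v => if v \in S then al else be) = 2 * (al - be) ^+ 2 * cut_flow S.
Proof.
have -> : 2 * (al - be) ^+ 2 * cut_flow S = (al - be) ^+ 2 * (cut_flow S + cut_flow (~: S)).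
  by rewrite cut_flow_balanced; ring.
rewrite /cut_flow finset.setCK /energy (bigID (mem S)) /= mulrDr; congr (_ + _).
  rewrite mulr_sumr; apply: eq_bigr => u ->.
  rewrite (bigID (mem S)) /= big1 ?add0r; last by move=> v ->; rewrite subrr expr0n mulr0.
  rewrite mulr_sumr; apply: eq_big => v; first by rewrite finset.in_setC.
  by move=> /negbTE ->; rewrite mulrC.
rewrite mulr_sumr; apply: eq_big => u; first by rewrite finset.in_setC.
move=> /negbTE ->; rewrite (bigID (mem S)) /= [X in _ + X]big1 ?addr0; last first.
  by move=> v /negbTE ->; rewrite subrr expr0n mulr0.
by rewrite mulr_sumr; apply: eq_bigr => v ->; ring.
Qed.

Lemma lambda2_le_cut S : dvexp_cut w S ->
  lambda2 (normalized_laplacian w A) <= 2 * dvexp_set E w S.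
Proof.
move=> /and3P[_ _]; rewrite lt_min => /andP[wS wSc].
have witness (T : {set V}) : 0 < weight w T -> exists2 v, v \in T & 0 < w v.
  move=> wT; have [v /andP[vT wv]|hn] := pickP [pred v | (v \in T) && (0 < w v)].
    by exists v.
  move: wT; rewrite /weight big1 ?ltxx // => v vT; apply/eqP; rewrite eq_le w_ge0 andbT leNgt.
  by have := hn v; rewrite /= vT /= => ->.
have [a aS wa] := witness S wS; have [b bS wb] := witness (~: S) wSc.
rewrite finset.in_setC in bS.
have V1 : (1 < #|V|)%N.
  by apply/card_gt1P; exists a, b; split=> //; apply: contraNneq bS => <-.
pose x1 : 'rV[R]_#|V| := \row_i (Num.sqrt (w (enum_val i)) * (enum_val i \in S)%:R).
pose x2 : 'rV[R]_#|V| := \row_i (Num.sqrt (w (enum_val i)) * (enum_val i \notin S)%:R).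
have xE al be v : (al *: x1 + be *: x2) 0 (enum_rank v) =
    Num.sqrt (w v) * (if v \in S then al else be).
  by rewrite !mxE enum_rankK; case: (v \in S) => /=; ring.
apply: (@lambda2_le _ _ _ _ V1 (normalized_laplacian_sym w A) x1 x2) => [al be x0|al be].
  have pos v : 0 < w v -> Num.sqrt (w v) != 0 by move=> wv; rewrite gt_eqF // sqrtr_gt0.
  have := xE al be a; have := xE al be b; rewrite x0 !mxE aS (negbTE bS).
  move=> /esym/eqP; rewrite mulf_eq0 (negbTE (pos _ wb)) => /eqP ->.
  by move=> /esym/eqP; rewrite mulf_eq0 (negbTE (pos _ wa)) => /eqP ->.
set x := _ + _; pose t v := if v \in S then al else be.
have xsq v : x 0 (enum_rank v) ^+ 2 = w v * t v ^+ 2 by rewrite xE exprMn sqr_sqrtr.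
have xt v : w v != 0 -> unscale w x v = t v.
  by move=> wv; rewrite /unscale xE mulKf // gt_eqF // sqrtr_gt0 lt_neqAle eq_sym wv w_ge0.
rewrite (form_laplacian A_feas) mx_form1E.
rewrite big1 ?add0r; last first.
  move=> v _; rewrite xsq; have [->|wv] := eqVneq (w v) 0; first by rewrite !mul0r subrr.
  by rewrite xt // subrr.
(* The two functions differ only at zeros of [w], whose rows and columns in [A] vanish. *)
have -> : energy A (unscale w x) = energy A t.
  apply: eq_bigr => u _; apply: eq_bigr => v _.
  have [->|Auv] := eqVneq (A u v) 0; first by rewrite !mul0r.
  have Apos : 0 < A u v by rewrite lt_neqAle eq_sym Auv A_ge0.
  have [lu lv] := feasible_le A_feas u v.
  by rewrite !xt // gt_eqF //; apply: lt_le_trans Apos _.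
rewrite energy_cut (reindex enum_rank) /=; last by exact: onW_bij (@enum_rank_bij V).
under eq_bigr do rewrite xsq.
rewrite (bigID (mem S)) /=.
have -> : \sum_(v in S) w v * t v ^+ 2 = al ^+ 2 * weight w S.
  by rewrite /weight mulr_sumr; apply: eq_bigr => v vS; rewrite /t vS mulrC.
have -> : \sum_(v | v \notin S) w v * t v ^+ 2 = be ^+ 2 * weight w (~: S).
  rewrite /weight mulr_sumr; apply: eq_big => v; first by rewrite finset.in_setC.
  by move=> vS; rewrite /t (negbTE vS) mulrC.
rewrite /dvexp_set; set m := Num.min (weight w S) _; set f := Num.min _ _.
have m0 : 0 < m by rewrite lt_min wS wSc.
have mS : m <= weight w S by rewrite ge_min lexx.
have mSc : m <= weight w (~: S) by rewrite ge_min lexx orbT.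
(* By balance the same flow is bounded by both boundary weights. The factor 2 comes from [(al - be)
   ^+ 2 <= 2 * (al ^+ 2 + be ^+ 2)]. *)
have ff : cut_flow S <= f.
  by rewrite le_min cut_flow_le -cut_flow_balanced cut_flow_le.
have f0 : 0 <= cut_flow S by rewrite sumr_ge0 // => u _; rewrite sumr_ge0.
apply: (@le_trans _ _ (2 * (f / m) * ((al ^+ 2 + be ^+ 2) * m))).
  have -> : 2 * (f / m) * ((al ^+ 2 + be ^+ 2) * m) = 2 * (al ^+ 2 + be ^+ 2) * f.
    by field; rewrite gt_eqF.
  have -> : 2^-1 * (2 * (al - be) ^+ 2 * cut_flow S) = (al - be) ^+ 2 * cut_flow S by field.
  have := sqr_ge0 (al - be); have := sqr_ge0 (al + be); nra.
rewrite ler_wpM2l //.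
  by rewrite mulr_ge0 // divr_ge0 // ?(le_trans f0 ff) // ltW.
by rewrite mulrDl lerD // ler_wpM2l // sqr_ge0.
Qed.

End Cut.

(** * Comparison of the gap and the expansion *)

Lemma sum_pair_variance (R : realType) (V : finType) (w y : V -> R) :
  \sum_v w v = 1 -> let m := \sum_v w v * y v in
  \sum_u \sum_v w u * w v * (y u - y v) ^+ 2 = 2 * \sum_u w u * (y u - m) ^+ 2.
Proof.
move=> w1 m; set Q := \sum_u w u * (y u - m) ^+ 2.
have m0 : \sum_v w v * (y v - m) = 0.
  by under eq_bigr do rewrite mulrBr; rewrite sumrB -mulr_suml w1 mul1r subrr.
transitivity (\sum_u (w u * (y u - m) ^+ 2 * (\sum_v w v) + w u * Q)); last first.
  by rewrite w1 big_split /= -!mulr_suml w1 -/Q; ring.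
apply: eq_bigr => u _.
transitivity (w u * (y u - m) ^+ 2 * (\sum_v w v) + w u * Q -
  2 * w u * (y u - m) * \sum_v w v * (y v - m)).
  by rewrite /Q !mulr_sumr -big_split -sumrB; apply: eq_bigr => v _ /=; ring.
by rewrite m0 mulr0 subr0.
Qed.

Section Expansion.
Variables (R : realType) (V : finType) (E : rel V) (w : V -> R).
Hypothesis E_refl : forall v, E v v.
Hypothesis w_ge0 : forall v, 0 <= w v.
Hypothesis w_pos2 : exists u v, [/\ u != v, 0 < w u & 0 < w v].

Let weight_sub (S T : {set V}) : S \subset T -> weight w S <= weight w T.
Proof.
move=> /fintype.subsetP ST; rewrite /weight [leLHS]big_mkcond [leRHS]big_mkcond.
by apply: ler_sum => v _; case: ifP => [/ST ->|_] //; case: ifP.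
Qed.

Lemma dvexp_cut_exists : exists u, 0 < w u /\ dvexp_cut w [set u]%SET.
Proof.
have [u [v [uv wu wv]]] := w_pos2; exists u; split => //.
apply/and3P; split.
- by apply/set0Pn; exists u; rewrite inE.
- by apply/eqP => /setP /(_ v); rewrite !inE eq_sym (negbTE uv).
- rewrite lt_min {1}/weight big_set1 wu (lt_le_trans wv) // /weight.
  by rewrite (bigD1 v) ?inE 1?eq_sym //= lerDl sumr_ge0.
Qed.

Lemma dvexp_set_ge0 S : 0 <= dvexp_set E w S.
Proof. by rewrite divr_ge0 // le_min !(weight_ge0 w_ge0). Qed.

Lemma dvexp_le S : dvexp_cut w S -> dvexp E w <= dvexp_set E w S.
Proof.
move=> cS; apply: ge_inf; last by exists S.
by exists 0 => _ [T _ ->]; exact: dvexp_set_ge0.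
Qed.

Lemma dvexp_ge r : (forall S, dvexp_cut w S -> r <= dvexp_set E w S) -> r <= dvexp E w.
Proof.
move=> h; apply: lb_le_inf => [|_ [T cT ->]]; last exact: h.
by have [u [_ cu]] := dvexp_cut_exists; exists (dvexp_set E w [set u]%SET), [set u]%SET.
Qed.

Lemma dvexp_ge0 : 0 <= dvexp E w.
Proof. by apply: dvexp_ge => S _; exact: dvexp_set_ge0. Qed.

(** The out-neighbours of each side of a cut lie on the other side, so the numerator is at most the
    denominator. *)
Lemma dvexp_le1 : dvexp E w <= 1.
Proof.
have [u [_ cu]] := dvexp_cut_exists; apply: le_trans (dvexp_le cu) _.
have /and3P[_ _ m0] := cu; rewrite ler_pdivrMr // mul1r le_min !ge_min.
apply/andP; split; apply/orP; [right | left]; apply: weight_sub; apply/fintype.subsetP => x.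
  by rewrite !inE => /andP[/negbNE].
by rewrite !inE => /andP[].
Qed.

Lemma dvexp_iso S :
  dvexp E w * Num.min (weight w S) (weight w (~: S)) <= weight w (out_neighbours E S).
Proof.
have [m0|m0] := leP (Num.min (weight w S) (weight w (~: S))) 0.
  apply: le_trans (weight_ge0 w_ge0 _); by rewrite mulr_ge0_le0 // dvexp_ge0.
have cS : dvexp_cut w S.
  rewrite /dvexp_cut m0 andbT; apply/andP; split; apply: contraTneq m0 => ->; rewrite -leNgt ge_min.
    by rewrite {1}/weight big_set0 lexx.
  by rewrite finset.setCT {2}/weight big_set0 lexx orbT.
have := dvexp_le cS; rewrite ler_pdivlMr // => /le_trans; apply.
by rewrite ge_min lexx.
Qed.

Lemma indegree_le v : (#|[pred u | E u v]| <= max_total_degree E)%N.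
Proof.
apply: leq_trans (leq_bigmax v); exact: leq_addl.
Qed.

Lemma max_total_degree_ge2 : (2 <= max_total_degree E)%N.
Proof.
have [u _] := dvexp_cut_exists; apply: leq_trans (leq_bigmax u).
by rewrite -[2%N]/(1 + 1)%N leq_add //; apply/card_gt0P; exists u; rewrite inE.
Qed.

(** Positive expansion gives [u] an out-neighbour besides itself, and its loop counts in both
    degrees. This keeps [Delta / lam] away from 1 in the final comparison. *)
Lemma max_total_degree_ge3 : 0 < dvexp E w -> (3 <= max_total_degree E)%N.
Proof.
have [u [wu cu]] := dvexp_cut_exists => psi0.
have /and3P[_ _ m0] := cu.
have := dvexp_iso [set u]%SET; set O := out_neighbours _ _ => hO.
have {hO} : 0 < weight w O by apply: lt_le_trans hO; rewrite mulr_gt0.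
have [O0|[v]] := finset.set_0Vmem O; first by rewrite O0 /weight big_set0 ltxx.
rewrite !inE => /andP[vu /exists_inP[u']]; rewrite inE => /eqP -> uv _.
apply: leq_trans (leq_bigmax u); rewrite -[3%N]/(2 + 1)%N leq_add //.
  by apply/card_gt1P; exists u, v; rewrite !inE eq_sym.
by apply/card_gt0P; exists u; rewrite inE.
Qed.

Lemma feasible_diag : feasible E w (fun u v => w u * (v == u)%:R).
Proof.
split => [u v|u v|u|u]; first by rewrite mulr_ge0.
- by have [->|] := eqVneq v u; rewrite ?E_refl // mulr0.
- rewrite -mulr_sumr -(eq_bigr _ (fun v _ => mul1r (v == u)%:R)) sum_delta.
  under eq_bigr => v _ do rewrite eq_sym; by rewrite sum_delta mulr1.
by rewrite -mulr_sumr -(eq_bigr _ (fun v _ => mul1r (v == u)%:R)) sum_delta mulr1.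
Qed.

Lemma max_reweighted_gap_le : max_reweighted_gap E w <= 2 * dvexp E w.
Proof.
rewrite -ler_pdivrMl //; apply: dvexp_ge => S cS; rewrite ler_pdivrMl //.
apply: ge_sup; first by eexists; eexists; first exact: feasible_diag.
by move=> _ [A fA ->]; exact: lambda2_le_cut.
Qed.

Lemma max_reweighted_gap_ge A : feasible E w A ->
  lambda2 (normalized_laplacian w A) <= max_reweighted_gap E w.
Proof.
move=> fA; apply: ub_le_sup; last by exists A.
have [u [_ cu]] := dvexp_cut_exists.
by exists (2 * dvexp_set E w [set u]%SET) => _ [B fB ->]; exact: lambda2_le_cut.
Qed.

End Expansion.

Section DualBound.
Variables (R : realType) (V : finType) (E : rel V) (w : V -> R).
Hypothesis E_refl : forall v, E v v.
Hypothesis w_ge0 : forall v, 0 <= w v.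
Hypothesis w_pos2 : exists u v, [/\ u != v, 0 < w u & 0 < w v].

Lemma dvexp_scale k S : 0 < k -> 
  dvexp E w * Num.min (weight (fun v => k * w v) S) (weight (fun v => k * w v) (~: S)) <=
  weight (fun v => k * w v) (out_neighbours E S).
Proof.
move=> k0; have sc T : weight (fun v => k * w v) T = k * weight w T by rewrite /weight mulr_sumr.
rewrite !sc -minr_pMr ?(ltW k0) // mulrCA ler_pM2l //; exact: dvexp_iso.
Qed.

(* The dual solution is recentred and rescaled to unit variance. *)
Lemma dvexp_le_dual_value (lam : R) ys a b :
  let W := \sum_v w v in
  0 < dvexp E w -> 0 < lam ->
  (forall u v, E u v -> \sum_(y <- ys) (y u - y v) ^+ 2 <= a u + b v) ->
  \sum_u w u * (a u + b u) <
    lam / W * \sum_u \sum_v w u * w v * \sum_(y <- ys) (y u - y v) ^+ 2 ->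
  dvexp E w ^+ 2 <= 5000 * lam * ln (max_total_degree E)%:R.
Proof.
move=> W psi0 lam0 dual val.
have W0 : 0 < W.
  by have [u [_ [_ wu _]]] := w_pos2; rewrite /W (bigD1 u) //= ltr_wpDr // sumr_ge0.
pose w' v := W^-1 * w v.
have w'_ge0 v : 0 <= w' v by rewrite mulr_ge0 // invr_ge0 ltW.
have w'1 : \sum_v w' v = 1 by rewrite -mulr_sumr mulVf // gt_eqF.
pose m y := \sum_v w' v * y v.
pose Z := \sum_(y <- ys) \sum_u w' u * (y u - m y) ^+ 2.
have ZE : \sum_u \sum_v w' u * w' v * \sum_(y <- ys) (y u - y v) ^+ 2 = 2 * Z.
  under eq_bigr => u _ do under eq_bigr => v _ do rewrite mulr_sumr.
  under eq_bigr => u _ do rewrite exchange_big.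
  by rewrite exchange_big mulr_sumr; apply: eq_bigr => y _; rewrite sum_pair_variance.
(* The dual constraint at the self-loop of [v]. *)
have ab_ge0 v : 0 <= a v + b v.
  apply: le_trans (dual v v (E_refl v)); apply: sumr_ge0 => y _; exact: sqr_ge0.
have val' : \sum_u w' u * (a u + b u) < 2 * lam * Z.
  have -> : \sum_u w' u * (a u + b u) = W^-1 * \sum_u w u * (a u + b u).
    by rewrite mulr_sumr; apply: eq_bigr => u _; rewrite mulrA.
  rewrite ltr_pdivrMl //; apply: lt_le_trans val _; rewrite le_eqVlt; apply/orP; left; apply/eqP.
  rewrite [2 * lam]mulrC -[lam * 2 * Z]mulrA -ZE !mulr_sumr; apply: eq_bigr => u _.
  by rewrite !mulr_sumr; apply: eq_bigr => v _; rewrite /w'; field; rewrite gt_eqF.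
(* The strict inequality [val'] excludes zero variance. *)
have Z0 : 0 < Z.
  have : 0 <= \sum_u w' u * (a u + b u) by apply: sumr_ge0 => u _; rewrite mulr_ge0.
  by move=> h; have := le_lt_trans h val'; rewrite pmulr_rgt0 // mulr_gt0.
have sZ : Num.sqrt Z != 0 by rewrite gt_eqF // sqrtr_gt0.
pose f (y : V -> R) v := (y v - m y) / Num.sqrt Z.
have sqf y (u v : V) : (f y u - f y v) ^+ 2 = Z^-1 * (y u - y v) ^+ 2.
  rewrite -[Z in RHS](sqr_sqrtr (ltW Z0)) /f; field; exact: sZ.
(* Taking [a + b] as [q] turns the edge bound [a u + b v] into [q v + a u - a v]; the factor
   [(2 * Z)^-1] matches the rescaling. *)
apply: (@expansion_le_dual_value R V E w' (dvexp E w) lam (max_total_degree E)%:R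
   E_refl w'_ge0 w'1 psi0 _ _ _ _ lam0 [seq f y | y <- ys]
   (fun u => (2 * Z)^-1 * a u) (fun u => (2 * Z)^-1 * (a u + b u))).
- exact: dvexp_le1.
- by move=> S; apply: dvexp_scale; rewrite invr_gt0.
- by rewrite ler_nat; exact: max_total_degree_ge2.
- by move=> v; rewrite ler_nat indegree_le.
- move=> i; have [si|si] := ltnP i (size ys); last first.
    by rewrite nth_default ?size_map // big1 // => u _; rewrite mulr0.
  rewrite (nth_map (fun=> 0)) // /f; set y := nth _ _ _.
  under eq_bigr do rewrite mulrA.
  rewrite -mulr_suml; under eq_bigr do rewrite mulrBr.
  by rewrite sumrB -mulr_suml w'1 mul1r subrr mul0r.
- under eq_bigr => u _ do rewrite big_map mulr_sumr.
  rewrite exchange_big /= -(mulVf (lt0r_neq0 Z0)) {2}/Z mulr_sumr; apply: eq_bigr => y _.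
  rewrite mulr_sumr; apply: eq_bigr => u _.
  rewrite -[Z in RHS](sqr_sqrtr (ltW Z0)) /f; field; exact: sZ.
- by move=> v; rewrite mulr_ge0 // invr_ge0 mulr_ge0 // ltW.
- move=> u v Euv; rewrite big_map.
  under eq_bigr do rewrite sqf.
  rewrite -mulr_sumr [leRHS](_ : _ = Z^-1 * (a u + b v)); last by field; rewrite gt_eqF.
  by rewrite ler_wpM2l ?invr_ge0 ?(ltW Z0) // dual.
- under eq_bigr do rewrite mulrCA.
  by rewrite -mulr_sumr ler_pdivrMl ?mulr_gt0 // mulrAC ltW.
Qed.

Lemma sqr_dvexp_le : 0 < dvexp E w ->
  dvexp E w ^+ 2 <= 10000 * max_reweighted_gap E w * ln (max_total_degree E)%:R.
Proof.
move=> psi0; set psi := dvexp E w in psi0 *; set L := ln _.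
have D2 := max_total_degree_ge2 E_refl w_ge0 w_pos2.
have L_ge : 2^-1 <= L.
  by apply: le_trans (ln2_ge R) _; rewrite ler_ln ?posrE ?ltr0n ?ler_nat // ltnW.
have L0 : 0 < L by apply: lt_le_trans L_ge; rewrite invr_gt0.
have psi1 : psi <= 1 by exact: dvexp_le1.
(* At this value the claim reads [lam <= max_reweighted_gap E w]. In the dual case the constant 5000
   would give [psi ^+ 2 <= psi ^+ 2 / 2]. *)
pose lam := psi ^+ 2 / (10000 * L).
have lam0 : 0 < lam by rewrite divr_gt0 ?mulr_gt0 ?exprn_gt0.
have lamE : psi ^+ 2 = 10000 * lam * L by rewrite /lam; field; rewrite gt_eqF.
have lam1 : lam <= 1.
  have : psi ^+ 2 <= 1 by rewrite expr_le1 // ltW.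
  rewrite lamE; nra.
have W0 : 0 < \sum_v w v.
  by have [u [_ [_ wu _]]] := w_pos2; rewrite (bigD1 u) //= ltr_wpDr // sumr_ge0.
have [[A fA hA]|[ys [a [b [dual val]]]]] := reweighting_duality E w (lam / \sum_v w v).
  rewrite lamE ler_pM2r // ler_pM2l //; apply: le_trans (max_reweighted_gap_ge w_ge0 w_pos2 fA).
  apply: (lambda2_ge_energy w_ge0 fA _ _ _ W0) => [||x].
  - by have [u [v [uv _ _]]] := w_pos2; apply/card_gt1P; exists u, v.
  - by rewrite lam1 ltW.
  - have := hA x; rewrite -(ler_pM2l W0); congr (_ <= _); field; exact: lt0r_neq0.
have := dvexp_le_dual_value psi0 lam0 dual val; rewrite -/psi -/L lamE.
have := mulr_gt0 lam0 L0; lra.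
Qed.

End DualBound.

Theorem theorem1p3 (R : realType) :
  exists c1 c2 c3 : R,
    [/\ 0 < c1, 0 < c2, 0 < c3
      & forall (V : finType) (E : rel V) (w : V -> R),
          (forall v, E v v) ->
          (forall v, 0 <= w v) ->
          (exists u v, [/\ u != v, 0 < w u & 0 < w v]) ->
          let lam := max_reweighted_gap E w in
          let psi := dvexp E w in
          let Delta : R := (max_total_degree E)%:R in
          [/\ lam <= c1 * psi,
              psi <= c2 * Num.sqrt (lam * ln (Delta / psi))
            & Num.sqrt (lam * ln (Delta / psi))
              <= c3 * Num.sqrt (lam * ln (Delta / lam))]].
Proof.
exists 2, 100, 2; split => // V E w E_refl w_ge0 w_pos2 lam psi Delta.
have easy : lam <= 2 * psi by exact: max_reweighted_gap_le.
have psi_ge0 : 0 <= psi by exact: dvexp_ge0.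
have psi_le1 : psi <= 1 by exact: dvexp_le1.
(* For [psi = 0] the conventions [0^-1 = 0] and [ln 0 = 0] make the middle term vanish. *)
have [psi0|psi0] := leP psi 0.
  have -> : psi = 0 by apply/eqP; rewrite eq_le psi0.
  rewrite mulr0 invr0 mulr0 ln0 // mulr0 sqrtr0 mulr0; split => //.
    by apply: le_trans easy _; rewrite pmulr_rle0.
  by rewrite mulr_ge0 // sqrtr_ge0.
have hard := sqr_dvexp_le E_refl w_ge0 w_pos2 psi0; rewrite -/psi -/lam -/Delta in hard.
have D3 : 3 <= Delta by rewrite ler_nat; exact: max_total_degree_ge3 psi0.
have D0 : 0 < Delta by lra.
have lnD0 : 0 <= ln Delta by rewrite ln_ge0 //; lra.
have lam0 : 0 < lam.
  rewrite ltNge; apply/negP => l0; have : 0 < psi ^+ 2 by rewrite exprn_gt0.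
  by rewrite ltNge (le_trans hard) // mulr_le0_ge0 // pmulr_rle0.
have lnD_psi : ln Delta <= ln (Delta / psi).
  by rewrite ler_ln ?posrE ?divr_gt0 // ler_pdivlMr // ler_piMr // ltW.
(* Since [lam <= 2 * psi <= 2] and [Delta >= 3]. As [2 <= (3 / 2) ^+ 2], the extra [ln 2] from
   replacing [psi] by [lam] is then at most [2 * ln (Delta / lam)]. *)
have r32 : 3 / 2 <= Delta / lam by rewrite ler_pdivlMr //; lra.
have ln32 : ln (3 / 2) <= ln (Delta / lam) by rewrite ler_ln ?posrE ?divr_gt0.
split => //.
  have -> : 100 = Num.sqrt (10000 : R).
    by rewrite [10000](_ : _ = 100 ^+ 2) ?sqrtr_sqr ?ger0_norm // -natrX.
  rewrite -sqrtrM //; apply: (@le_trans _ _ (Num.sqrt (psi ^+ 2))).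
    by rewrite sqrtr_sqr ger0_norm.
  apply: ler_wsqrtr; apply: le_trans hard _.
  by rewrite -mulrA ler_pM2l // ler_pM2l.
have -> : 2 = Num.sqrt (4 : R).
  by rewrite [4](_ : _ = 2 ^+ 2) ?sqrtr_sqr ?ger0_norm // -natrX.
rewrite -sqrtrM //; apply: ler_wsqrtr; rewrite mulrCA ler_pM2l //.
have step1 : ln (Delta / psi) <= ln 2 + ln (Delta / lam).
  rewrite -lnM ?posrE ?divr_gt0 // ler_ln ?posrE ?mulr_gt0 ?divr_gt0 ?invr_gt0 //.
  by rewrite mulrCA ler_pM2l // ler_pdivlMr // mulrC ler_pdivrMr // mulrC.
have step2 : ln 2 <= 2 * ln (3 / 2) :> R.
  rewrite mulr_natl -lnXn ?divr_gt0 // ler_ln ?posrE ?exprn_gt0 ?divr_gt0 //; lra.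
have step3 : 0 <= ln (3 / 2) :> R by rewrite ln_ge0 //; lra.
lra.
Qed.
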